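(* Let $k$ be a positive integer and $N>2k$. Then there exist $k$ positive constants $C_{k,0}^i$ ($i=1,\dots,k$) such that $$\int_{\mathbb{H}^N}|\nabla_r^k u|^2\,dv_{\mathbb{H}^N}-\Big(\frac{N-1}{2}\Big)^{2k}\int_{\mathbb{H}^N}u^2\,dv_{\mathbb{H}^N}\ \ge\ \sum_{i=1}^{k}C_{k,0}^i\int_{\mathbb{H}^N}\frac{u^2}{r^{2i}}\,dv_{\mathbb{H}^N}$$ for all $u\in C_c^\infty(\mathbb{H}^N\setminus\{o\})$. Moreover, the leading constants are explicitly given by $$C_{k,0}^k=\begin{cases}\Big(\dfrac{N-4}{2^{2m}}\Big)^2\displaystyle\prod_{j=1}^{m-1}(N+4j)^2(N-4j-4)^2 & \text{if } k=2m,\\[2mm] \dfrac{1}{2^{4m+2}}\displaystyle\prod_{j=1}^{m}(N+4j-2)^2(N-4j-2)^2 & \text{if } k=2m+1,\end{cases}$$ and $$C_{k,0}^1=\begin{cases}\dfrac{N(N-1)}{2^{4m}}\displaystyle\sum_{j=1}^{m}(N-1)^{4m-2j-2} & \text{if } k=2m,\\[2mm] \dfrac{N(N-1)}{2^{4m+2}}\displaystyle\sum_{j=1}^{m}(N-1)^{2m+2j-2}+\dfrac{(N-1)^{2m}}{2^{4m+2}} & \text{if } k=2m+1.\end{cases}$$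
   Context: $\mathbb{H}^N$ is the $N$-dimensional hyperbolic space with a fixed pole $o$. In geodesic polar coordinates $x=(r,\sigma)\in(0,\infty)\times\mathbb{S}^{N-1}$ about $o$, with $r$ the geodesic distance from $x$ to $o$, the metric is $dr^2+\sinh^2 r\,d\omega^2$ ($d\omega^2$ the standard metric on $\mathbb{S}^{N-1}$), and $dv_{\mathbb{H}^N}=(\sinh r)^{N-1}\,dr\,d\sigma$ is the volume element. The radial gradient and radial Laplacian are $$\nabla_r u=\Big(\frac{\partial u}{\partial r},0\Big),\quad |\nabla_r u|^2=\Big(\frac{\partial u}{\partial r}\Big)^2,\qquad \Delta_r u=\frac{\partial^2u}{\partial r^2}+(N-1)\coth r\,\frac{\partial u}{\partial r}.$$ For a non-negative integer $k$, $\nabla_r^k u=\Delta_r^{k/2}u$ if $k$ is even and $\nabla_r^k u=\nabla_r\Delta_r^{(k-1)/2}u$ if $k$ is odd, where $\Delta_r^j$ is the $j$-th iterate of $\Delta_r$. Empty sums are $0$ and empty products are $1$. The constants depend only on $N$, $k$ and $i$, not on $u$. *)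

(* Defs.v *)
From HB Require Import structures.
From mathcomp Require Import all_boot all_order all_algebra.
From mathcomp Require Import all_classical all_reals all_analysis.
From mathcomp Require Import measurable_realfun.

Set Implicit Arguments.
Unset Strict Implicit.
Unset Printing Implicit Defensive.

Import Order.TTheory GRing.Theory Num.Theory.
Import numFieldTopology.Exports numFieldNormedType.Exports.

Local Open Scope classical_set_scope.
Local Open Scope ring_scope.

(* N-dimensional hyperbolic space is modelled by R^N in geodesic normal
   coordinates at the pole o: the point with polar coordinates (r, sigma) is
   the row vector r *: sigma, o is 0, and the geodesic distance to o is the
   Euclidean norm [enorm].  Since exp_o is a diffeomorphism from R^N onto H^N,
   smoothness and compactness of supports are the usual ones of R^N. *)

Section image_measure.
Context d1 d2 (T1 : measurableType d1) (T2 : measurableType d2) (R : realType).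
Variables (mu : {measure set T1 -> \bar R}) (f : {mfun T1 >-> T2}).

Definition image_measure := pushforward mu f.

Let image_measure0 : image_measure set0 = 0%E.
Proof. exact: measure0. Qed.

Let image_measure_ge0 A : (0 <= image_measure A)%E.
Proof. exact: measure_ge0. Qed.

Let image_measure_sigma_additive : semi_sigma_additive image_measure.
Proof. exact: measure_semi_sigma_additive. Qed.

HB.instance Definition _ := isMeasure.Build _ _ _ image_measure
  image_measure0 image_measure_ge0 image_measure_sigma_additive.

End image_measure.

Section Lebesgue_measure_on_tuples.
Context {R : realType}.
Local Notation mR := (measurableTypeR R).

Definition tcons n (p : mR * n.-tuple mR) : n.+1.-tuple mR :=
  [tuple of p.1 :: p.2].

Let measurable_tcons n : measurable_fun [set: mR * n.-tuple mR] (@tcons n).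
Proof. by apply: measurable_cons. Qed.

HB.instance Definition _ n := isMeasurableFun.Build _ _ _ _ (@tcons n)
  (@measurable_tcons n).

Definition pcons n (mu : {sigma_finite_measure set (n.-tuple mR) -> \bar R}) :=
  image_measure ((@lebesgue_measure R : set mR -> \bar R) \x mu)%E (@tcons n).

Section pcons_measure.
Variables (n : nat) (mu : {sigma_finite_measure set (n.-tuple mR) -> \bar R}).

HB.instance Definition _ := Measure.on (pcons mu).

Let uncons (t : n.+1.-tuple mR) : mR * n.-tuple mR :=
  (thead t, [tuple of behead t]).

Let tconsK : cancel (@tcons n) uncons.
Proof. by case=> a t; congr pair; apply/val_inj. Qed.

Let measurable_uncons : measurable_fun setT uncons.
Proof.
apply/measurable_fun_pair; [exact: measurable_tnth|exact: measurable_behead].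
Qed.

Let pcons_sigma_finite : sigma_finite setT (pcons mu).
Proof.
have /sigma_finiteP[F [TF ndF Foo]] :=
  sigma_finiteT (@lebesgue_measure R : {sigma_finite_measure set mR -> \bar R}).
have /sigma_finiteP[G [TG ndG Goo]] := sigma_finiteT mu.
exists (fun i => uncons @^-1` (F i `*` G i)).
  rewrite -preimage_bigcup (_ : \bigcup_i _ = setT) ?preimage_setT//.
  rewrite -subTset => -[x y] _.
  have : (\bigcup_i F i) x by rewrite -TF.
  have : (\bigcup_i G i) y by rewrite -TG.
  move=> [k _ Gky] [n' _ Fnx]; exists (maxn n' k) => //; split => /=.
  - by move: x Fnx; exact/subsetPset/ndF/leq_maxl.
  - by move: y Gky; exact/subsetPset/ndG/leq_maxr.
move=> i; have [mFi Fi] := Foo i; have [mGi Gi] := Goo i; split.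
  rewrite -[X in measurable X]setTI; apply: measurable_uncons => //.
  exact: measurableX.
rewrite /pcons /image_measure /pushforward -comp_preimage.
rewrite (_ : uncons \o _ = id); last by apply/funext => p /=; exact: tconsK.
by rewrite preimage_id /= product_measure1E ?lte_mul_pinfty// ge0_fin_numE.
Qed.

HB.instance Definition _ := Measure_isSigmaFinite.Build _ _ _ (pcons mu)
  pcons_sigma_finite.

End pcons_measure.

Fixpoint lebesgue_tuple n : {sigma_finite_measure set (n.-tuple mR) -> \bar R} :=
  match n with
  | 0 => \d_([tuple] : 0.-tuple mR)
  | n'.+1 => pcons (lebesgue_tuple n')
  end.

Lemma measurable_box n :
  measurable [set t : n.-tuple mR | forall i, `|tnth t i| <= 1].
Proof.
rewrite (_ : mkset _ =
    \bigcap_(i in [set: 'I_n]) ((@tnth _ _)^~ i @^-1` `[-1, 1])); last first.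
  apply/seteqP; split => t /= H i.
    by move=> _; rewrite /= in_itv /= -ler_norml.
  by have := H i I; rewrite /= in_itv /= -ler_norml.
apply: fin_bigcap_measurable => // i _.
by rewrite -[X in measurable X]setTI; apply: measurable_tnth.
Qed.

Lemma lebesgue_tuple_box n :
  (lebesgue_tuple n [set t | forall i, `|tnth t i| <= 1]%R < +oo)%E.
Proof.
elim: n => [|n IH] /=; first by rewrite diracE ltry.
rewrite /pcons /image_measure /pushforward /=.
have -> : @tcons n @^-1` [set t | forall i, `|tnth t i| <= 1] =
    `[-1, 1] `*` [set t | forall i, `|tnth t i| <= 1].
  apply/seteqP; split => -[a t] /=.
    move=> H; split.
      by have := H ord0; rewrite /tcons /= in_itv /= -ler_norml.
    by move=> i; have := H (lift ord0 i); rewrite tnthS.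
  rewrite in_itv /= -ler_norml => -[Ha Ht] i.
  by have [j ->|->] := unliftP ord0 i; [rewrite tnthS | exact: Ha].
rewrite product_measure1E //=; last exact: measurable_box.
apply: lte_mul_pinfty => //; rewrite /= lebesgue_measure_itv /=.
  by case: ifP => _ //; rewrite -EFinD.
Qed.

End Lebesgue_measure_on_tuples.

Section sphere.
Context {R : realType}.
Local Notation mR := (measurableTypeR R).

Definition enorm N (x : 'rV[R]_N) : R := Num.sqrt (\sum_(i < N) x 0 i ^+ 2).

Definition point N (t : N.-tuple mR) : 'rV[R]_N := \row_i tnth t i.

Definition normalize N (t : N.-tuple mR) : N.-tuple mR :=
  [tuple tnth t i / enorm (point t) | i < N].

Lemma measurable_enorm N :
  measurable_fun setT (fun t : N.-tuple mR => enorm (point t)).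
Proof.
rewrite (_ : (fun _ => _) =
    (fun t => (\sum_(i < N) tnth t i ^+ 2) `^ 2^-1)); last first.
  apply/funext => t; rewrite powR12_sqrt ?sumr_ge0// => [|i _]; last exact: sqr_ge0.
  by congr Num.sqrt; apply: eq_bigr => i _; rewrite mxE.
apply: (@measurableT_comp _ _ _ _ _ _ (@powR R ^~ 2^-1)) => //.
apply: measurable_sum => i; apply: measurable_funX; exact: measurable_tnth.
Qed.

Lemma measurable_normalize N : measurable_fun setT (@normalize N).
Proof.
apply/measurable_fun_tnthP => i.
rewrite (_ : _ \o _ = fun t => tnth t i * enorm (point t) `^ (-1)); last first.
  by apply/funext => t /=; rewrite tnth_mktuple powR_inv1 ?sqrtr_ge0.
apply: measurable_funM; first exact: measurable_tnth.
apply: (@measurableT_comp _ _ _ _ _ _ (@powR R ^~ (-1))) => //.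
exact: measurable_enorm.
Qed.

HB.instance Definition _ N := isMeasurableFun.Build _ _ _ _ (@normalize N)
  (@measurable_normalize N).

Definition unit_ball N : set (N.-tuple mR) :=
  [set t | 0 < enorm (point t) <= 1].
Definition unit_sphere N : set (N.-tuple mR) :=
  [set t | enorm (point t) = 1].

Lemma measurable_unit_ball N : measurable (@unit_ball N).
Proof.
have -> : @unit_ball N = (fun t => enorm (point t)) @^-1` [set` `]0, 1]].
  by apply/seteqP; split => t; rewrite /unit_ball /= in_itv.
by rewrite -[X in measurable X]setTI; apply: measurable_enorm.
Qed.

(* The surface measure of the unit sphere as the cone measure: A |-> N times
   the volume of the cone {t sigma : 0 < t <= 1, sigma in A}.  It is carried by
   [unit_sphere N]. *)
Definition sphere_measure N : set (N.-tuple mR) -> \bar R :=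
  mscale (N%:R%:nng : {nonneg R})
    (image_measure (mrestr (lebesgue_tuple N) (@measurable_unit_ball N))
       (@normalize N)).

HB.instance Definition _ N := Measure.on (@sphere_measure N).

Let unit_ball_box N : @unit_ball N `<=` [set t | forall i, `|tnth t i| <= 1].
Proof.
move=> t /andP[_ t1] i /=; apply: le_trans t1.
rewrite -sqrtr_sqr ler_sqrt ?sumr_ge0// => [|j _]; last exact: sqr_ge0.
by rewrite (bigD1 i)//= mxE lerDl sumr_ge0// => j _; exact: sqr_ge0.
Qed.

Let sphere_measure_fin N : fin_num_fun (@sphere_measure N).
Proof.
move=> A mA; rewrite ge0_fin_numE ?measure_ge0//.
rewrite /sphere_measure /mscale lte_mul_pinfty ?lee_fin//.
rewrite /image_measure /pushforward /mrestr.
apply: le_lt_trans (@lebesgue_tuple_box R N).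
apply: le_measure; rewrite ?inE; last by move=> t [_ /unit_ball_box].
  apply: measurableI; last exact: measurable_unit_ball.
  by rewrite -[X in measurable X]setTI; apply: measurable_normalize.
exact: measurable_box.
Qed.

HB.instance Definition _ N := Measure_isFinite.Build _ _ _ (@sphere_measure N)
  (@sphere_measure_fin N).

End sphere.

Section hyperbolic_space.
Context {R : realType} (N : nat).
Local Notation mR := (measurableTypeR R).
Implicit Types (f u : 'rV[R]_N -> R) (x : 'rV[R]_N).

Definition sinh (r : R) : R := (expR r - expR (- r)) / 2.
Definition cosh (r : R) : R := (expR r + expR (- r)) / 2.
Definition coth (r : R) : R := cosh r / sinh r.

(* dv = (sinh r)^(N-1) dr dsigma, over (r, sigma) in (0, oo) x S^(N-1) *)
Definition hyp_integral f : \bar R :=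
  (\int[(@lebesgue_measure R : set mR -> \bar R) \x @sphere_measure R N]_(
      p in `]0%R, +oo[ `*` @unit_sphere R N)
    (f (p.1 *: point p.2)%R * sinh p.1 ^+ N.-1)%:E)%E.

(* du/dr: the derivative along the unit vector x / |x|, for x != 0 *)
Definition dr u x : R := 'D_((enorm x)^-1 *: x) u x.

Definition radial_laplacian u x : R :=
  dr (dr u) x + (N%:R - 1) * coth (enorm x) * dr u x.

(* |nabla_r^k u|^2, where |nabla_r v|^2 = (dv/dr)^2 *)
Definition nabla_r_sq k u x : R :=
  let v := iter k./2 radial_laplacian u in
  if odd k then dr v x ^+ 2 else v x ^+ 2.

Definition partial (i : 'I_N) f x : R := 'D_(delta_mx 0 i) f x.

Fixpoint Ck n f : Prop :=
  continuous f /\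
  if n is n'.+1 then
    forall i, (forall x, derivable f x (delta_mx 0 i)) /\ Ck n' (partial i f)
  else True.

Definition smooth f := forall n, Ck n f.

Definition support f : set 'rV[R]_N := closure [set x | f x != 0].

(* C_c^oo(H^N \ {o}), its elements being extended by 0 at the pole *)
Definition test_function f :=
  [/\ smooth f, compact (support f) & ~ support f 0].

End hyperbolic_space.

Section leading_constants.
Context {R : realType} (N k : nat).
Let n : R := N%:R.
Let m := k./2.

Definition leading_const : R :=
  if odd k then
    (2 ^+ (4 * m + 2))^-1 *
      \prod_(1 <= j < m.+1) ((n + 4 * j%:R - 2) ^+ 2 * (n - 4 * j%:R - 2) ^+ 2)
  else
    ((n - 4) / 2 ^+ (2 * m)) ^+ 2 *
      \prod_(1 <= j < m) ((n + 4 * j%:R) ^+ 2 * (n - 4 * j%:R - 4) ^+ 2).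

Definition first_const : R :=
  if odd k then
    n * (n - 1) / 2 ^+ (4 * m + 2) *
      \sum_(1 <= j < m.+1) (n - 1) ^+ (2 * m + 2 * j - 2)
    + (n - 1) ^+ (2 * m) / 2 ^+ (4 * m + 2)
  else
    n * (n - 1) / 2 ^+ (4 * m) *
      \sum_(1 <= j < m.+1) (n - 1) ^+ (4 * m - 2 * j - 2).

End leading_constants.

(* Main.v *)
Require Import Defs.
From mathcomp Require Import all_boot all_order all_algebra.
From mathcomp Require Import all_classical all_reals all_analysis.
From mathcomp Require Import measurable_realfun.
From mathcomp Require Import ring lra zify.

Set Implicit Arguments.
Unset Strict Implicit.
Unset Printing Implicit Defensive.

Import Order.TTheory GRing.Theory Num.Theory.
Import numFieldTopology.Exports numFieldNormedType.Exports.

Local Open Scope classical_set_scope.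
Local Open Scope ring_scope.

(** Write n = N - 1, s = sinh r and w = s^n.  All the operators involved are
radial, so the inequality can be proved on each ray from the pole and then
integrated over the sphere.  On a ray a test function becomes a smooth function
f of r > 0 supported in some [a, b] with a > 0, the radial Laplacian becomes
L f = f'' + n coth r f', and integrals are taken against w dr.

Two inequalities on a ray carry the proof.  For k = 1, expanding
(f' + p f)^2 >= 0 with p = (n/2) coth r - 1/(2r) and integrating by parts bounds
the integral of f'^2 below by that of (n^2/4 + 1/(4 r^2)) f^2; this is
[poincare_hardy_exact].  For the second-order operator with a weight rho, the
two squares rho (L f + (Q/rho) f)^2 and 2 Q (f' + p f)^2 with
p = (n/2) coth r - c/r are expanded instead ([rellich_exact]).  The choice of p
removes every coth, and Q = A r^(-m) + B r^(-m-2) gives an explicit weight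
([rellich_power_exact]) in which only 1/r^2 and 1/s^2 occur.  Since
1/s^2 >= 1/r^2 - 1/2 ([invsinh2_ge]), choosing A, B and c yields

 - for rho = 1, the weight n^4/16 + n (n+1)/(16 r^2) + (n-3)^2/(16 r^4)
   ([rellich_poincare_exact]);
 - for rho = r^(-2i) with i >= 1, the weight n^2/16 r^(-2i) + B_i^2 r^(-2i-4)
   with B_i = (N + 2i) (N - 4 - 2i) / 4 ([rellich_weighted_exact]).

Applying these to each power of 1/r in the inequality of order k, written for
L f, produces the inequality of order k + 2 for f.  The recursion for the
coefficients is [hardy_coef]: the top one is multiplied by B_k^2 when k >= 1, the first one
receives n (n+1)/16 times the Poincare constant of order k plus n^2/16 times the
previous first one, and every other one is a sum of nonnegative terms at least
one of which is positive.  Solving the recursion at both ends gives the stated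
closed forms ([hardy_coef_leading], [hardy_coef_first]).

The remaining work is analytic: the restriction of a smooth function to a ray is
smooth (the mean value theorem, one coordinate at a time), the iterated radial
derivatives are measurable in (r, sigma) as limits of difference quotients, and
Tonelli's theorem assembles the rays ([hyp_integral_le]). *)

(** * Calculus on the open half-line *)

Section half_line_calculus.
Context {R : realType}.
Implicit Types (f g h : R -> R) (r c : R) (n : nat).

Lemma is_derive1_add f g r df dg : is_derive r 1 f df -> is_derive r 1 g dg ->
  is_derive r 1 (fun s => f s + g s) (df + dg).
Proof. exact: is_deriveD. Qed.

Lemma is_derive1_sub f g r df dg : is_derive r 1 f df -> is_derive r 1 g dg ->
  is_derive r 1 (fun s => f s - g s) (df - dg).
Proof. exact: is_deriveB. Qed.

Lemma is_derive1_mul f g r df dg : is_derive r 1 f df -> is_derive r 1 g dg ->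
  is_derive r 1 (fun s => f s * g s) (df * g r + f r * dg).
Proof.
move=> fr gr; apply: is_derive_eq (is_deriveM fr gr) _.
by rewrite /GRing.scale /=; ring.
Qed.

Lemma is_derive1_ext f g r df dg : is_derive r 1 f df -> f =1 g -> df = dg ->
  is_derive r 1 g dg.
Proof. by move=> fr /funext <- <-. Qed.

Lemma near_pos r (P : R -> Prop) : 0 < r -> (forall s, 0 < s -> P s) ->
  \forall s \near r, P s.
Proof.
move=> r0 HP; have := lt_nbhsr r0; apply: filterS => s; exact: HP.
Qed.

Lemma is_derive_eq_pos f g r df : 0 < r -> (forall s, 0 < s -> f s = g s) ->
  is_derive r 1 f df -> is_derive r 1 g df.
Proof. by move=> r0 fg; apply: near_eq_is_derive; exact: near_pos. Qed.

Lemma derive1_val f r df : is_derive r 1 f df -> (derive1 f) r = df.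
Proof. by move=> fr; rewrite derive1E derive_val. Qed.

Lemma derive1_eq_pos f g r : 0 < r -> (forall s, 0 < s -> f s = g s) ->
  (derive1 f) r = (derive1 g) r.
Proof.
by move=> r0 fg; rewrite !derive1E; apply: near_eq_derive; exact: near_pos.
Qed.

(** The derivative is carried by an existential, so that a formula valid only for
r > 0 can be supplied for it; functions such as coth, whose derivative is a
polynomial in themselves, are then handled by induction on n. *)
Fixpoint Cn_pos n f : Prop :=
  if n is n'.+1 then
    exists2 f1, forall r, 0 < r -> is_derive r 1 f (f1 r) & Cn_pos n' f1
  else True.

Definition smooth_pos f := forall n, Cn_pos n f.

Lemma Cn_pos_eq n f g : (forall r, 0 < r -> f r = g r) ->
  Cn_pos n f -> Cn_pos n g.
Proof.
case: n => //= n fg [f1 ff1 Cf1]; exists f1 => // r r0.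
exact: is_derive_eq_pos (ff1 r r0).
Qed.

Lemma Cn_posS n f : Cn_pos n.+1 f -> Cn_pos n f.
Proof.
elim: n f => //= n IH f [f1 ff1 Cf1]; exists f1 => //; exact: IH.
Qed.

Lemma Cn_pos_cst n c : Cn_pos n (fun=> c).
Proof.
elim: n c => //= n IH c; exists (fun=> 0) => // r _; exact: is_derive_cst.
Qed.

Lemma Cn_posD n f g : Cn_pos n f -> Cn_pos n g ->
  Cn_pos n (fun r => f r + g r).
Proof.
elim: n f g => //= n IH f g [f1 ff1 Cf1] [g1 gg1 Cg1].
exists (fun r => f1 r + g1 r); last exact: IH.
move=> r r0; exact: is_derive1_add (ff1 r r0) (gg1 r r0).
Qed.

Lemma Cn_posM n f g : Cn_pos n f -> Cn_pos n g ->
  Cn_pos n (fun r => f r * g r).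
Proof.
elim: n f g => //= n IH f g Cf Cg.
have [f1 ff1 Cf1] := Cf; have [g1 gg1 Cg1] := Cg.
exists (fun r => f1 r * g r + f r * g1 r).
  move=> r r0; exact: is_derive1_mul (ff1 r r0) (gg1 r r0).
by apply: Cn_posD; apply: IH => //; exact: Cn_posS.
Qed.

Lemma smooth_pos_eq f g : (forall r, 0 < r -> f r = g r) ->
  smooth_pos f -> smooth_pos g.
Proof. by move=> fg Cf n; exact: Cn_pos_eq (Cf n). Qed.

Lemma smooth_pos_cst c : smooth_pos (fun=> c).
Proof. by move=> n; exact: Cn_pos_cst. Qed.

Lemma smooth_posD f g : smooth_pos f -> smooth_pos g ->
  smooth_pos (fun r => f r + g r).
Proof. by move=> Cf Cg n; exact: Cn_posD. Qed.

Lemma smooth_posM f g : smooth_pos f -> smooth_pos g ->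
  smooth_pos (fun r => f r * g r).
Proof. by move=> Cf Cg n; exact: Cn_posM. Qed.

Lemma smooth_posZ c f : smooth_pos f -> smooth_pos (fun r => c * f r).
Proof. exact/smooth_posM/smooth_pos_cst. Qed.

Lemma smooth_posB f g : smooth_pos f -> smooth_pos g ->
  smooth_pos (fun r => f r - g r).
Proof.
move=> Cf Cg; apply: smooth_posD => //.
by apply: smooth_pos_eq (smooth_posZ (-1) Cg) => r _; rewrite mulN1r.
Qed.

Lemma smooth_posX f n : smooth_pos f -> smooth_pos (fun r => f r ^+ n).
Proof.
move=> Cf; elim: n => [|n IH].
  by apply: smooth_pos_eq (smooth_pos_cst 1) => r _; rewrite expr0.
by apply: smooth_pos_eq (smooth_posM Cf IH) => r _; rewrite exprS.
Qed.

Lemma smooth_pos_is_derive f r : smooth_pos f -> 0 < r ->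
  is_derive r 1 f ((derive1 f) r).
Proof.
move=> /(_ 1%N) [f1 ff1 _] r0; have H := ff1 r r0.
by rewrite (derive1_val H).
Qed.

Lemma smooth_pos_derive f : smooth_pos f -> smooth_pos (derive1 f).
Proof.
move=> Cf n; have [f1 ff1 Cf1] := Cf n.+1.
by apply: Cn_pos_eq Cf1 => r r0; rewrite (derive1_val (ff1 r r0)).
Qed.

Lemma smooth_pos_continuous f r : smooth_pos f -> 0 < r ->
  {for r, continuous f}.
Proof.
move=> Cf r0; apply/differentiable_continuous/derivable1_diffP.
by have [] := smooth_pos_is_derive Cf r0.
Qed.

(** A fixed interval [a, b] controls every support, so that the class is
stable under all the operations used below. *)
Definition supported_in (a b : R) f :=
  forall r, 0 < r -> ~~ (a <= r <= b) -> f r = 0.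

Lemma supported_inM (a b : R) f g : supported_in a b f ->
  supported_in a b (fun r => f r * g r).
Proof. by move=> sf r r0 rab; rewrite sf// mul0r. Qed.

Lemma supported_in_derive (a b : R) f : supported_in a b f ->
  supported_in a b (derive1 f).
Proof.
move=> sf r r0; rewrite negb_and -!ltNge => rab.
rewrite derive1E (@near_eq_derive _ _ _ f (cst 0)) ?derive_cst//.
case/orP: rab => [ra|br].
  near=> s; apply: sf; first by near: s; exact: lt_nbhsr.
  rewrite negb_and -!ltNge; apply/orP; left.
  by near: s; exact: lt_nbhsl.
near=> s; apply: sf; first by near: s; exact: lt_nbhsr.
rewrite negb_and -!ltNge; apply/orP; right.
by near: s; exact: lt_nbhsr.
Unshelve. all: by end_near.
Qed.

End half_line_calculus.

Section hyperbolic_functions.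
Context {R : realType}.
Implicit Types (r : R) (n : nat).

Local Notation sinh := (@sinh R).
Local Notation cosh := (@cosh R).
Local Notation coth := (@coth R).

Lemma is_derive_expRN r : is_derive r 1 (fun s => expR (- s)) (- expR (- r)).
Proof.
apply: is_derive_eq (is_derive1_comp (f := expR) (g := -%R) _ _) _.
by rewrite mulrN1.
Qed.

Lemma is_derive_sinh r : is_derive r 1 sinh (cosh r).
Proof.
apply: is_derive1_ext (is_derive1_mul (is_derive1_sub (is_derive_expR r)
  (is_derive_expRN r)) (is_derive_cst (2^-1 : R) r 1)) _ _ => //.
by rewrite /Defs.cosh /=; ring.
Qed.

Lemma is_derive_cosh r : is_derive r 1 cosh (sinh r).
Proof.
apply: is_derive1_ext (is_derive1_mul (is_deriveD (is_derive_expR r)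
  (is_derive_expRN r)) (is_derive_cst (2^-1 : R) r 1)) _ _ => //.
by rewrite /Defs.sinh /=; ring.
Qed.

Lemma cosh2E r : cosh r ^+ 2 = 1 + sinh r ^+ 2.
Proof.
have : expR r * expR (- r) = 1 :> R by rewrite -expRD subrr expR0.
rewrite /Defs.cosh /Defs.sinh; move: (expR r) (expR (- r)) => x y xy.
suff -> : ((x + y) / 2) ^+ 2 = x * y + ((x - y) / 2) ^+ 2 by rewrite xy.
by field.
Qed.

Lemma sinh0 : sinh 0 = 0.
Proof. by rewrite /Defs.sinh oppr0 subrr mul0r. Qed.

Lemma sinh_gt0 r : 0 < r -> 0 < sinh r.
Proof. by move=> r0; rewrite divr_gt0// subr_gt0 ltr_expR; lra. Qed.

Lemma sinh_ge0 r : 0 <= r -> 0 <= sinh r.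
Proof.
by rewrite le_eqVlt => /predU1P[<-|/sinh_gt0/ltW//]; rewrite sinh0.
Qed.

Lemma cosh_gt0 r : 0 < cosh r.
Proof. by rewrite divr_gt0// addr_gt0// expR_gt0. Qed.

Lemma sinh_double r : sinh (r + r) = 2 * sinh r * cosh r.
Proof. by rewrite /Defs.sinh /Defs.cosh opprD !expRD; field. Qed.

Lemma smooth_pos_sinh_cosh : smooth_pos sinh /\ smooth_pos cosh.
Proof.
suff H n : Cn_pos n sinh /\ Cn_pos n cosh by split=> n; have [] := H n.
elim: n => // n [Cs Cc]; split; [exists cosh|exists sinh] => // r _.
  exact: is_derive_sinh.
exact: is_derive_cosh.
Qed.

Lemma smooth_pos_sinh : smooth_pos sinh.
Proof. by have [] := smooth_pos_sinh_cosh. Qed.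

Lemma is_derive_inv r : 0 < r ->
  is_derive r 1 (fun s : R => s^-1) (- (r^-1 * r^-1)).
Proof.
move=> r0; have rn0 : r != 0 by rewrite gt_eqF.
apply: is_derive_eq (is_deriveV (f := id) rn0 (is_derive_id r 1)) _.
by rewrite /GRing.scale /=; field.
Qed.

Lemma smooth_pos_inv : smooth_pos (fun r : R => r^-1).
Proof.
elim=> //= n IH; exists (fun r => - (r^-1 * r^-1)).
  exact: is_derive_inv.
apply: Cn_pos_eq (Cn_posM (Cn_pos_cst n (-1)) (Cn_posM IH IH)) => r _.
by rewrite mulN1r.
Qed.

Lemma is_derive_invX n r : 0 < r ->
  is_derive r 1 (fun s : R => s^-1 ^+ n) (- (n%:R * r^-1 ^+ n.+1)).
Proof.
move=> r0; have rn0 : r != 0 by rewrite gt_eqF.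
apply: is_derive1_ext (is_deriveX n (is_derive_inv r0)) _ _.
  by move=> s; rewrite exprfctE.
rewrite /GRing.scale /=; case: n => [|n] /=; first by ring.
by rewrite !exprS; ring.
Qed.

Lemma is_derive_coth r : 0 < r -> is_derive r 1 coth (1 - coth r * coth r).
Proof.
move=> r0; have sr0 := sinh_gt0 r0; have sn0 : sinh r != 0 by rewrite gt_eqF.
apply: is_derive1_ext
  (is_derive1_mul (is_derive_cosh r) (is_deriveV sn0 (is_derive_sinh r))) _ _ => //.
by rewrite /GRing.scale /= /Defs.coth; field.
Qed.

Lemma smooth_pos_coth : smooth_pos coth.
Proof.
elim=> //= n IH; exists (fun r => 1 - coth r * coth r).
  exact: is_derive_coth.
have := Cn_posD (Cn_pos_cst n 1) (Cn_posM (Cn_pos_cst n (-1)) (Cn_posM IH IH)).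
by apply: Cn_pos_eq => r _; rewrite mulN1r.
Qed.

Lemma is_derive_sinhX n r : 0 < r ->
  is_derive r 1 (fun s => sinh s ^+ n) (n%:R * coth r * sinh r ^+ n).
Proof.
move=> r0; have sr0 := sinh_gt0 r0; have sn0 : sinh r != 0 by rewrite gt_eqF.
apply: is_derive1_ext (is_deriveX n (is_derive_sinh r)) _ _.
  by move=> s; rewrite exprfctE.
rewrite /GRing.scale /= /Defs.coth; case: n => [|n] /=; first by ring.
by rewrite exprS; field.
Qed.

Lemma coth2E r : 0 < r -> coth r ^+ 2 = 1 + (sinh r)^-1 ^+ 2.
Proof.
move=> r0; have sr0 := sinh_gt0 r0; have sn0 : sinh r != 0 by rewrite gt_eqF.
by rewrite /Defs.coth expr_div_n cosh2E mulrDl mul1r divff ?expf_neq0// exprVn addrC.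
Qed.

(** The function r cosh r - sinh r vanishes at 0 and has derivative
r sinh r. *)
Lemma sinh_le_rcosh r : 0 <= r -> sinh r <= r * cosh r.
Proof.
move=> r0; pose f s := s * cosh s - sinh s.
have df (s : R) : is_derive s 1 f (s * sinh s).
  apply: is_derive1_ext (is_derive1_sub (is_derive1_mul (is_derive_id s 1)
    (is_derive_cosh s)) (is_derive_sinh s)) _ _ => //.
  by rewrite mul1r; ring.
have cf : {within `[0, r], continuous f}.
  by apply: derivable_within_continuous => s _; case: (df s).
have [c cr] := MVT_segment r0 (fun s _ => df s) cf.
rewrite {1 2}/f mul0r sinh0 !subr0 => fr; rewrite -subr_ge0 fr.
move: cr; rewrite in_itv /= => /andP[c0 _].
by apply: mulr_ge0 => //; apply: mulr_ge0 => //; exact: sinh_ge0.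
Qed.

(** With t = r / 2 and y = 1 / sinh^2 t, the bound tanh t <= t reads
y >= 1 / t^2 - 1, while the duplication formula gives
1 / sinh^2 r = y^2 / (4 (1 + y)) = (y - 1 + 1 / (1 + y)) / 4. *)
Lemma invsinh2_ge r : 0 < r -> r^-1 ^+ 2 - 2^-1 <= (sinh r)^-1 ^+ 2.
Proof.
move=> r0; pose t := r / 2; have t0 : 0 < t by rewrite divr_gt0.
have rE : r = t + t by rewrite /t; field.
have st0 := sinh_gt0 t0; have ct0 := cosh_gt0 t.
have sE : sinh r = 2 * sinh t * cosh t by rewrite rE sinh_double.
have tc := sinh_le_rcosh (ltW t0).
have -> : r^-1 ^+ 2 = t^-1 ^+ 2 / 4 by rewrite /t; field; rewrite gt_eqF.
rewrite sE; move: (cosh2E t).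
move: (sinh t) (cosh t) st0 ct0 tc => x c x0 c0 tc cE.
have xn0 : x != 0 by rewrite gt_eqF.
have cn0 : c != 0 by rewrite gt_eqF.
have x2n0 : 1 + x ^+ 2 != 0 by rewrite -cE expf_neq0.
pose y := x^-1 ^+ 2; have y0 : 0 < y by rewrite exprn_gt0// invr_gt0.
have -> : (2 * x * c)^-1 ^+ 2 = y ^+ 2 / (4 * (1 + y)).
  have -> : (2 * x * c)^-1 ^+ 2 = (4 * x ^+ 2 * c ^+ 2)^-1 by field; rewrite cn0.
  by rewrite cE /y; field; rewrite xn0 addrC.
have ty : t^-1 ^+ 2 <= 1 + y.
  have -> : 1 + y = (c / x) ^+ 2 by rewrite expr_div_n cE /y; field.
  rewrite ler_pXn2r ?nnegrE ?invr_ge0 ?divr_ge0 ?(ltW t0) ?(ltW r0) ?(ltW c0) ?(ltW x0)//.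
  by rewrite -[t^-1]mul1r ler_pdivrMr// mulrAC ler_pdivlMr// mul1r mulrC.
rewrite ler_pdivlMr; last by lra.
nra.
Qed.

End hyperbolic_functions.

(** * Weighted inequalities on a ray, modulo exact derivatives *)

Section ray_inequalities.
Context {R : realType} (a b : R) (n : nat).
Implicit Types (f g h G Q V rho : R -> R) (r c : R) (i k : nat).

Local Notation n_ := (n%:R : R).
Local Notation w := (fun r : R => sinh r ^+ n).

Definition radial_op f r : R :=
  derive1 (derive1 f) r + n_ * coth r * derive1 f r.

Definition test_on f := smooth_pos f /\ supported_in a b f.

Lemma radial_op_eq f g r : 0 < r -> (forall s, 0 < s -> f s = g s) ->
  radial_op f r = radial_op g r.
Proof.
move=> r0 fg; have fg1 s (s0 : 0 < s) := derive1_eq_pos s0 fg.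
by rewrite /radial_op (derive1_eq_pos r0 fg) (derive1_eq_pos r0 fg1).
Qed.

Lemma test_on_radial_op f : test_on f -> test_on (radial_op f).
Proof.
move=> [Cf sf]; split.
  apply: smooth_posD; first by do 2!apply: smooth_pos_derive.
  by do ?[exact: smooth_pos_derive|exact: smooth_pos_coth|
          exact: smooth_pos_cst|apply: smooth_posM].
have s1 := supported_in_derive sf; have s2 := supported_in_derive s1.
by move=> r r0 rab; rewrite /radial_op s1// s2// mulr0 addr0.
Qed.

Lemma test_on_iter f k : test_on f -> test_on (iter k radial_op f).
Proof. by move=> tf; elim: k => //= k; exact: test_on_radial_op. Qed.

(** An inequality between the integrals of h1 and h2, stored with its
certificate: the pointwise difference dominates the derivative of a compactly
supported function.  Certificates add up and compose without any integrability
side condition, so integration is performed only once, at the very end. *)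
Definition le_exact h1 h2 := exists G,
  test_on G /\ forall r, 0 < r -> h1 r + derive1 G r <= h2 r.

Lemma test_on0 : test_on (fun=> 0).
Proof. by split=> //; exact: smooth_pos_cst. Qed.

Lemma le_exact_le h1 h2 : (forall r, 0 < r -> h1 r <= h2 r) -> le_exact h1 h2.
Proof.
move=> h12; exists (fun=> 0); split=> [|r r0]; first exact: test_on0.
by rewrite (derive1_val (is_derive_cst 0 r 1)) addr0 h12.
Qed.

Lemma le_exactD h1 h2 g1 g2 : le_exact h1 h2 -> le_exact g1 g2 ->
  le_exact (fun r => h1 r + g1 r) (fun r => h2 r + g2 r).
Proof.
move=> [F [[CF sF] Fle]] [G [[CG sG] Gle]].
exists (fun r => F r + G r); split; first split.
- exact: smooth_posD.
- by move=> r r0 rab; rewrite sF// sG// addr0.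
move=> r r0; rewrite (derive1_val (is_derive1_add
  (smooth_pos_is_derive CF r0) (smooth_pos_is_derive CG r0))).
by rewrite addrACA lerD ?Fle ?Gle.
Qed.

Lemma le_exactZ c h1 h2 : 0 <= c -> le_exact h1 h2 ->
  le_exact (fun r => c * h1 r) (fun r => c * h2 r).
Proof.
move=> c0 [G [[CG sG] Gle]].
exists (fun r => c * G r); split; first split.
- exact: smooth_posZ.
- by move=> r r0 rab; rewrite sG// mulr0.
move=> r r0; rewrite (derive1_val (is_derive1_mul
  (is_derive_cst c r 1) (smooth_pos_is_derive CG r0))).
by rewrite mul0r add0r -mulrDr ler_wpM2l ?Gle.
Qed.

Lemma le_exact_sum k (h1 h2 : nat -> R -> R) :
  (forall i, (i < k)%N -> le_exact (h1 i) (h2 i)) ->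
  le_exact (fun r => \sum_(i < k) h1 i r) (fun r => \sum_(i < k) h2 i r).
Proof.
elim: k => [|k IH] h12.
  by apply: le_exact_le => r _; rewrite !big_ord0.
have [G [tG Gle]] := le_exactD (IH (fun i ik => h12 i (ltnW ik))) (h12 k (ltnSn k)).
by exists G; split=> // r r0; rewrite !big_ord_recr; exact: Gle.
Qed.

Lemma le_exact_trans h2 h1 h3 : le_exact h1 h2 -> le_exact h2 h3 ->
  le_exact h1 h3.
Proof.
move=> h12 h23; have [G [tG Gle]] := le_exactD h12 h23.
by exists G; split=> // r /Gle; lra.
Qed.

(** Completing the square with p = (n/2) coth r - 1/(2r): the integral of
(f' + p f)^2 sinh^n r is nonnegative, and p' + n p coth r - p^2 equals
n^2/4 + 1/(4 r^2) + n (n - 2) / (4 sinh^2 r). *)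
Lemma poincare_hardy_exact f : (2 <= n)%N -> test_on f ->
  le_exact (fun r => (n_ ^+ 2 / 4 + r^-1 ^+ 2 / 4) * f r ^+ 2 * w r)
           (fun r => derive1 f r ^+ 2 * w r).
Proof.
move=> n2 [Cf sf]; have n2' : 2 <= n_ by rewrite ler_nat.
pose q (r : R) : R := r^-1 / 2 - n_ / 2 * coth r.
exists (fun r => f r * (f r * (q r * w r))); split; first split.
- do 3!apply: smooth_posM => //; last exact/smooth_posX/smooth_pos_sinh.
  apply: smooth_posB; last exact/smooth_posZ/smooth_pos_coth.
  by apply: smooth_posM; [exact: smooth_pos_inv|exact: smooth_pos_cst].
- exact: supported_inM.
move=> r r0; have f1 := smooth_pos_is_derive Cf r0.
have q1 : is_derive r 1 q (- (r^-1 ^+ 2) / 2 - n_ / 2 * (1 - coth r ^+ 2)).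
  apply: is_derive1_ext (is_derive1_sub
    (is_derive1_mul (is_derive_inv r0) (is_derive_cst (2^-1 : R) r 1))
    (is_derive1_mul (is_derive_cst (n_ / 2) r 1) (is_derive_coth r0))) _ _ => //=.
  by ring.
rewrite (derive1_val (is_derive1_mul f1 (is_derive1_mul f1
  (is_derive1_mul q1 (is_derive_sinhX n r0))))).
have := coth2E r0; have := sqr_ge0 (sinh r)^-1.
have : 0 < sinh r ^+ n by rewrite exprn_gt0 ?sinh_gt0.
rewrite /q; move: (coth r) (sinh r ^+ n) ((sinh r)^-1 ^+ 2) => C W y W0 y0 Cy.
move: (f r) (derive1 f r) (r^-1) => F F1 z; rewrite -subr_ge0.
have -> : F1 ^+ 2 * W - ((n_ ^+ 2 / 4 + z ^+ 2 / 4) * F ^+ 2 * W +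
    (F1 * (F * ((z / 2 - n_ / 2 * C) * W)) +
     F * (F1 * ((z / 2 - n_ / 2 * C) * W) +
          F * ((- z ^+ 2 / 2 - n_ / 2 * (1 - C ^+ 2)) * W +
               (z / 2 - n_ / 2 * C) * (n_ * C * W))))) =
  W * ((F1 - (z / 2 - n_ / 2 * C) * F) ^+ 2 +
       n_ * (n_ - 2) / 4 * (C ^+ 2 - 1) * F ^+ 2) by field.
rewrite Cy addrAC subrr add0r; apply: mulr_ge0; first exact: ltW.
rewrite addr_ge0 ?sqr_ge0// mulr_ge0 ?sqr_ge0// mulr_ge0// divr_ge0// mulr_ge0//.
by rewrite subr_ge0.
Qed.

(** Two squares are discarded, namely rho (L f + (Q/rho) f)^2 for the radial
operator L and 2 Q (f' + p f)^2 with p = (n/2) coth r - c/r.  The first one turns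
L f into the energy 2 Q f'^2, which the second one bounds; for this p all the
terms with coth r cancel. *)
Lemma rellich_exact f Q rho c : test_on f -> smooth_pos Q ->
  (forall r, 0 < r -> 0 <= Q r) -> (forall r, 0 < r -> 0 < rho r) ->
  le_exact
    (fun r => (2 * Q r * (n_ ^+ 2 / 4 + n_ * (n_ - 2) / 4 * (sinh r)^-1 ^+ 2
                          + (c - c ^+ 2) * r^-1 ^+ 2)
               - 2 * c * r^-1 * derive1 Q r - derive1 (derive1 Q) r
               - Q r ^+ 2 / rho r) * f r ^+ 2 * w r)
    (fun r => rho r * radial_op f r ^+ 2 * w r).
Proof.
move=> [Cf sf] CQ Q0 rho0.
have Cf1 := smooth_pos_derive Cf; have CQ1 := smooth_pos_derive CQ.
pose p (r : R) : R := n_ / 2 * coth r - c * r^-1.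
have Cp : smooth_pos p.
  apply: smooth_posB; first exact/smooth_posZ/smooth_pos_coth.
  exact/smooth_posZ/smooth_pos_inv.
pose H (r : R) : R := (derive1 Q r - 2 * (Q r * p r)) * f r - 2 * (Q r * derive1 f r).
(* the boundary term w ((Q' - 2 Q p) f^2 - 2 Q f f') of both integrations by
   parts *)
exists (fun r => f r * (w r * H r)); split; first split.
- apply: smooth_posM => //; apply: smooth_posM.
    exact/smooth_posX/smooth_pos_sinh.
  apply: smooth_posB; last by apply: smooth_posZ; apply: smooth_posM.
  apply: smooth_posM => //; apply: smooth_posB => //.
  by apply: smooth_posZ; apply: smooth_posM.
- exact: supported_inM.
move=> r r0; have f1 := smooth_pos_is_derive Cf r0.
have f2 := smooth_pos_is_derive Cf1 r0.
have Q1 := smooth_pos_is_derive CQ r0; have Q2 := smooth_pos_is_derive CQ1 r0.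
have p1 : is_derive r 1 p (n_ / 2 * (1 - coth r ^+ 2) + c * r^-1 ^+ 2).
  apply: is_derive1_ext (is_derive1_sub
    (is_derive1_mul (is_derive_cst (n_ / 2) r 1) (is_derive_coth r0))
    (is_derive1_mul (is_derive_cst c r 1) (is_derive_inv r0))) _ _ => //=.
  by ring.
have two := is_derive_cst (2 : R) r 1.
have H1 := is_derive1_sub (is_derive1_mul (is_derive1_sub Q2 (is_derive1_mul two
  (is_derive1_mul Q1 p1))) f1) (is_derive1_mul two (is_derive1_mul Q1 f2)).
rewrite (derive1_val (is_derive1_mul f1
  (is_derive1_mul (is_derive_sinhX n r0) H1))) /= /cst.
have := coth2E r0; have W0 : 0 < sinh r ^+ n by rewrite exprn_gt0 ?sinh_gt0.
have := Q0 r r0; have := rho0 r r0.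
rewrite /radial_op /H /p; move: (coth r) (sinh r ^+ n) W0 ((sinh r)^-1 ^+ 2) => C W W0 y.
move: (f r) (derive1 f r) (derive1 (derive1 f) r) (r^-1) => F F1 F2 z.
move: (Q r) (derive1 Q r) (derive1 (derive1 Q) r) (rho r) => q q1 q2 o o0 q0 Cy.
have -> : y = C ^+ 2 - 1 by rewrite Cy; ring.
rewrite -subr_ge0; set e := (X in 0 <= X).
suff -> : e = W * (o * (F2 + n_ * C * F1 + q / o * F) ^+ 2
                   + 2 * q * (F1 + (n_ / 2 * C - c * z) * F) ^+ 2).
  have := sqr_ge0 (F2 + n_ * C * F1 + q / o * F).
  have := sqr_ge0 (F1 + (n_ / 2 * C - c * z) * F).
  move=> s1 s2; apply: mulr_ge0; first exact: ltW.
  by rewrite addr_ge0// mulr_ge0// ?mulr_ge0// ltW.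
by rewrite /e; field; rewrite gt_eqF.
Qed.

End ray_inequalities.

Section ray_rellich.
Context {R : realType} (a b : R) (n : nat).
Implicit Types (f : R -> R) (r c : R) (i j k m : nat).

Local Notation n_ := (n%:R : R).
Local Notation w := (fun r : R => sinh r ^+ n).
Local Notation le_exact := (le_exact a b).
Local Notation test_on := (test_on a b).
Local Notation radial_op := (radial_op n).

Lemma rellich_power_exact f m (A B c : R) : test_on f -> 0 <= A -> 0 <= B ->
  le_exact
    (fun r => r^-1 ^+ m *
       (2 * (A + B * r^-1 ^+ 2)
          * (n_ ^+ 2 / 4 + n_ * (n_ - 2) / 4 * (sinh r)^-1 ^+ 2
             + (c - c ^+ 2) * r^-1 ^+ 2)
        + r^-1 ^+ 2 * (A * m%:R * (2 * c - m%:R - 1)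
                       + B * (m%:R + 2) * (2 * c - m%:R - 3) * r^-1 ^+ 2)
        - (A + B * r^-1 ^+ 2) ^+ 2) * f r ^+ 2 * w r)
    (fun r => r^-1 ^+ m * radial_op f r ^+ 2 * w r).
Proof.
move=> tf A0 B0; pose Q (r : R) : R := A * r^-1 ^+ m + B * r^-1 ^+ m.+2.
have CQ : smooth_pos Q.
  by apply: smooth_posD; apply/smooth_posZ/smooth_posX/smooth_pos_inv.
have Q0 r : 0 < r -> 0 <= Q r.
  by move=> r0; rewrite addr_ge0// mulr_ge0// exprn_ge0// invr_ge0 ltW.
have rho0 r : 0 < r -> 0 < r^-1 ^+ m by move=> r0; rewrite exprn_gt0 ?invr_gt0.
have [G [tG Gle]] := rellich_exact n c tf CQ Q0 rho0.
exists G; split=> // r r0; apply: le_trans (Gle r r0).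
rewrite lerD2r le_eqVlt; apply/orP; left; apply/eqP; congr (_ * _ * _).
have dX k (D s : R) : 0 < s -> is_derive s 1 (fun s => D * s^-1 ^+ k)
    (D * - k%:R * s^-1 ^+ k.+1).
  move=> s0; apply: is_derive1_ext (is_derive1_mul (is_derive_cst D s 1)
    (is_derive_invX k s0)) _ _ => //=.
  by ring.
have Q1 (s : R) : 0 < s ->
    derive1 Q s = A * - m%:R * s^-1 ^+ m.+1 + B * - m.+2%:R * s^-1 ^+ m.+3.
  by move=> s0; rewrite (derive1_val (is_derive1_add (dX _ _ _ s0) (dX _ _ _ s0))).
rewrite (derive1_eq_pos r0 Q1) Q1//.
rewrite (derive1_val (is_derive1_add (dX _ _ _ r0) (dX _ _ _ r0))) /Q.
rewrite -(@natr1 R m.+2) -(@natr1 R m.+1) -(@natr1 R m) !exprS.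
move: (rho0 r r0); move: (r^-1 ^+ m) (r^-1) ((sinh r)^-1) => Z z y Z0.
by field; rewrite gt_eqF.
Qed.

(** With Q = n^2/4 + 1/(4 r^2) and c = 1/2 the constant term n^4/16 is attained.
What remains is an inequality between y = 1/r^2 and 1/sinh^2 r, which follows
from 1/sinh^2 r >= max (0, y - 1/2). *)
Lemma rellich_poincare_exact f : (4 <= n)%N -> test_on f ->
  le_exact (fun r => (n_ ^+ 4 / 16 + n_ * (n_ + 1) / 16 * r^-1 ^+ 2
                      + (n_ - 3) ^+ 2 / 16 * r^-1 ^+ 4) * f r ^+ 2 * w r)
           (fun r => radial_op f r ^+ 2 * w r).
Proof.
move=> n4 tf; have n4' : 4 <= n_ by rewrite ler_nat.
have A0 : 0 <= n_ ^+ 2 / 4 by rewrite divr_ge0// sqr_ge0.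
have B0 : 0 <= 4^-1 :> R by rewrite invr_ge0.
have [G [tG Gle]] := rellich_power_exact 0 2^-1 tf A0 B0.
exists G; split=> // r r0; have := Gle r r0; rewrite expr0 mul1r mul1r.
apply: le_trans; rewrite lerD2r.
have W0 : 0 < sinh r ^+ n by rewrite exprn_gt0 ?sinh_gt0.
rewrite ler_pM2r// ler_wpM2r ?sqr_ge0//.
have y0 : 0 <= (sinh r)^-1 ^+ 2 by rewrite sqr_ge0.
have := invsinh2_ge r0; have z0 : 0 < r^-1 ^+ 2 by rewrite exprn_gt0 ?invr_gt0.
have -> : r^-1 ^+ 4 = (r^-1 ^+ 2) ^+ 2 by rewrite -exprM.
move: (r^-1 ^+ 2) z0 ((sinh r)^-1 ^+ 2) y0 => y y0 t t0 ty.
rewrite -subr_ge0; set e := (X in 0 <= X).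
have -> : e = n_ ^+ 3 * (n_ - 2) / 8 * t + y / 16 *
    (2 * n_ * (n_ - 2) * t + n_ * (n_ - 1) - (n_ ^+ 2 - 6 * n_ + 24) * y).
  by rewrite /e; field.
apply: addr_ge0.
  by apply: mulr_ge0 => //; rewrite divr_ge0// mulr_ge0 ?exprn_ge0//; lra.
apply: mulr_ge0; first by rewrite divr_ge0// ltW.
have nn : 0 <= 2 * n_ * (n_ - 2) by nra.
have [yh|yh] := leP y 2^-1.
  have p0 : 0 <= n_ ^+ 2 - 6 * n_ + 24 by nra.
  have p1 : 0 <= n_ ^+ 2 + 4 * n_ - 24 by nra.
  have := mulr_ge0 nn t0; have := ler_wpM2l p0 yh; lra.
have p0 : 0 <= n_ ^+ 2 + 2 * n_ - 24 by nra.
have := ler_wpM2l nn ty; have := mulr_ge0 p0 (ltW y0); lra.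
Qed.

(** The choice c = (2i + 3)/2, followed by that of B, maximises the coefficient of
1/r^(2i+4), which is the sharp Euclidean one.  The constant A makes the
coefficient of 1/r^(2i), namely A (n (n + 2)/4 - A), as large as possible, which
exceeds n^2/16; the coefficient of 1/r^(2i+2) is nonnegative and dropped. *)
Lemma rellich_weighted_exact f i : (1 <= i)%N -> (2 * i + 3 < n)%N -> test_on f ->
  le_exact
    (fun r => (n_ ^+ 2 / 16 * r^-1 ^+ (2 * i) +
      ((n_ + 1 + 2 * i%:R) * (n_ - 3 - 2 * i%:R) / 4) ^+ 2
        * r^-1 ^+ (2 * i + 4)) * f r ^+ 2 * w r)
    (fun r => r^-1 ^+ (2 * i) * radial_op f r ^+ 2 * w r).
Proof.
move=> i1 n4 tf; set m : R := i%:R.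
have m1 : 1 <= m by rewrite ler1n.
have n4' : 2 * m + 4 <= n_ by rewrite /m -natrM -natrD ler_nat -addnS in n4 *.
pose A := n_ * (n_ + 2) / 8; pose B := (n_ + 1 + 2 * m) * (n_ - 3 - 2 * m) / 4.
have A0 : 0 <= A by rewrite /A; nra.
have B0 : 0 <= B by rewrite /B divr_ge0// mulr_ge0//; lra.
have [G [tG Gle]] := rellich_power_exact (2 * i) ((2 * m + 3) / 2) tf A0 B0.
exists G; split=> // r r0; have := Gle r r0.
apply: le_trans; rewrite lerD2r.
have W0 : 0 < sinh r ^+ n by rewrite exprn_gt0 ?sinh_gt0.
rewrite ler_pM2r// ler_wpM2r ?sqr_ge0//.
have Z0 : 0 < r^-1 ^+ (2 * i) by rewrite exprn_gt0 ?invr_gt0.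
rewrite (exprD _ (2 * i) 4) -/B.
have -> : n_ ^+ 2 / 16 * r^-1 ^+ (2 * i) + B ^+ 2 * (r^-1 ^+ (2 * i) * r^-1 ^+ 4)
  = r^-1 ^+ (2 * i) * (n_ ^+ 2 / 16 + B ^+ 2 * r^-1 ^+ 4) by ring.
rewrite ler_pM2l// natrM -/m.
have := invsinh2_ge r0; have z0 : 0 < r^-1 ^+ 2 by rewrite exprn_gt0 ?invr_gt0.
have -> : r^-1 ^+ 4 = (r^-1 ^+ 2) ^+ 2 by rewrite -exprM.
move: (r^-1 ^+ 2) z0 ((sinh r)^-1 ^+ 2) => y y0 t ty.
rewrite -subr_ge0; set e := (X in 0 <= X).
have -> : e = n_ * (n_ - 2) / 2 * (A + B * y) * (t - (y - 2^-1))
    + n_ ^+ 3 * (n_ + 4) / 64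
    + (B * (n_ * (n_ + 2)) / 4 + 4 * m * A) * y.
  by rewrite /e /A /B; field.
have nn : 0 <= n_ * (n_ - 2) / 2 by nra.
have n0 : 0 <= n_ by lra.
have AB : 0 <= A + B * y by rewrite addr_ge0// mulr_ge0// ltW.
have nn' : 0 <= n_ * (n_ + 2) by nra.
apply: addr_ge0; [apply: addr_ge0|apply: mulr_ge0 (ltW y0); apply: addr_ge0].
- by apply: mulr_ge0; [exact: mulr_ge0|rewrite subr_ge0].
- by rewrite divr_ge0// mulr_ge0 ?exprn_ge0// addr_ge0.
- by rewrite divr_ge0// mulr_ge0.
- by rewrite mulr_ge0//; lra.
Qed.

End ray_rellich.

(** * The constants and the iteration along a ray *)

Section constants.
Context {R : realType} (n : nat).
Implicit Types (i j k m : nat).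

Local Notation n_ := (n%:R : R).

Definition rellich_factor i : R := (n_ + 1 + 2 * i%:R) * (n_ - 3 - 2 * i%:R) / 4.

(** Going from k to k + 2 replaces each weight 1/r^(2i) by the lower bound
given by the second-order inequality with that weight; the coefficients of
equal powers are then collected. *)
Fixpoint hardy_coef k j : R :=
  match k with
  | 0 => (j == 0%N)%:R
  | 1 => match j with 0 => n_ ^+ 2 / 4 | 1 => 4^-1 | _ => 0 end
  | k'.+2 => match j with
    | 0 => hardy_coef k' 0 * (n_ ^+ 4 / 16)
    | 1 => hardy_coef k' 0 * (n_ * (n_ + 1) / 16)
             + hardy_coef k' 1 * (n_ ^+ 2 / 16)
    | 2 => hardy_coef k' 0 * ((n_ - 3) ^+ 2 / 16)
             + hardy_coef k' 2 * (n_ ^+ 2 / 16)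
    | j'.+3 => hardy_coef k' j'.+3 * (n_ ^+ 2 / 16)
             + hardy_coef k' j'.+1 * rellich_factor j'.+1 ^+ 2
    end
  end.

Lemma nat_ind2 (P : nat -> Prop) : P 0%N -> P 1%N ->
  (forall k, P k -> P k.+2) -> forall k, P k.
Proof.
move=> P0 P1 PS k; suff [] : P k /\ P k.+1 by [].
by elim: k => // k [Pk Pk1]; split=> //; exact: PS.
Qed.

Lemma hardy_coefSS1 k : hardy_coef k.+2 1 =
  hardy_coef k 0 * (n_ * (n_ + 1) / 16) + hardy_coef k 1 * (n_ ^+ 2 / 16).
Proof. by []. Qed.

Lemma hardy_coefSSS k j : hardy_coef k.+2 j.+3 =
  hardy_coef k j.+3 * (n_ ^+ 2 / 16)
  + hardy_coef k j.+1 * rellich_factor j.+1 ^+ 2.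
Proof. by []. Qed.

Lemma hardy_coef_gt k j : (k < j)%N -> hardy_coef k j = 0.
Proof.
elim/nat_ind2: k j => [[|j]//|[|[|j]]//|k IH [|[|[|j]]]//= kj].
all: by rewrite !IH ?mul0r ?addr0//; move: kj; lia.
Qed.

Lemma hardy_coef0 k : hardy_coef k 0 = (n_ / 2) ^+ (2 * k).
Proof.
elim/nat_ind2: k => [|/=|k /= ->]; first by rewrite muln0 expr0.
  by rewrite muln1; field.
by rewrite (_ : 2 * k.+2 = 2 * k + 4)%N; [rewrite exprD; field|lia].
Qed.

Lemma hardy_coef_ge0 k j : 0 <= hardy_coef k j.
Proof.
have n2 : 0 <= n_ ^+ 2 / 16 by rewrite divr_ge0// sqr_ge0.
elim/nat_ind2: k j => [j|[|[|j]]|k IH [|[|[|j]]]]//=.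
- by rewrite mulr_ge0 ?divr_ge0 ?exprn_ge0.
- by rewrite addr_ge0 ?mulr_ge0 ?divr_ge0 ?mulr_ge0 ?addr_ge0.
- have n3 : 0 <= (n_ - 3) ^+ 2 / 16 by apply: divr_ge0 => //; exact: sqr_ge0.
  by apply: addr_ge0; apply: mulr_ge0.
- by apply: addr_ge0; apply: mulr_ge0 => //; exact: sqr_ge0.
Qed.

Lemma rellich_factor_gt0 i : (2 * i + 3 < n)%N -> 0 < rellich_factor i.
Proof.
move=> ni; have : 2 * i%:R + 4 <= n_ by rewrite -natrM -natrD ler_nat; lia.
by move=> ?; rewrite divr_gt0// mulr_gt0//; have : 0 <= i%:R :> R by []; lra.
Qed.

Lemma hardy_coef_gt0 k j : (2 * k <= n)%N -> (1 <= j <= k)%N ->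
  0 < hardy_coef k j.
Proof.
elim/nat_ind2: k j => [[|j]//|[|[|j]]//= _ _|k IH [|j]// kn jk].
have n0 : 4 <= n_ by rewrite ler_nat; lia.
have h0 : 0 < hardy_coef k 0 by rewrite hardy_coef0 exprn_gt0 ?divr_gt0//; lra.
have H i : 0 <= hardy_coef k i * (n_ ^+ 2 / 16).
  by rewrite mulr_ge0 ?hardy_coef_ge0// divr_ge0// sqr_ge0.
case: j jk => [|[|j]] jk /=; [apply: ltr_pwDl|apply: ltr_pwDl|apply: ltr_wpDl] => //.
- by rewrite mulr_gt0// divr_gt0// mulr_gt0//; lra.
- by rewrite mulr_gt0// divr_gt0// exprn_gt0//; lra.
- by rewrite mulr_gt0 ?IH ?exprn_gt0 ?rellich_factor_gt0//; lia.
Qed.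

Lemma hardy_coef_leading k : (0 < k)%N -> hardy_coef k k = leading_const n.+1 k.
Proof.
have nS : n.+1%:R = n_ + 1 by rewrite natr1.
elim/nat_ind2: k => [//| |[|k] IH _].
- by move=> _ /=; rewrite /leading_const /= muln0 expr2 big_geq//; field.
- by rewrite /= /leading_const /= big_geq// nS muln1; field.
rewrite hardy_coefSSS hardy_coef_gt// mul0r add0r IH// /leading_const /=.
rewrite negbK nS; case: ifP => ok.
  rewrite [in RHS]big_nat_recr//=.
  rewrite (_ : 4 * (uphalf k).+1 + 2 = (4 * uphalf k + 2) + 4)%N; last by lia.
  rewrite (exprD 2 (4 * uphalf k + 2) 4) /rellich_factor.
  have -> : k.+1%:R = 2 * (uphalf k)%:R + 1 :> R.
    rewrite -natrM natr1; congr (_%:R).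
    by have := odd_double_half k.+1; rewrite /= ok /= uphalfE; lia.
  rewrite -(natr1 (uphalf k)).
  by field; rewrite expf_neq0.
have k1 : (k.+1 = 2 * uphalf k)%N.
  by have := odd_double_half k.+1; rewrite /= ok /= uphalfE; lia.
rewrite (@big_nat_recr _ _ _ (uphalf k)) /=; last by lia.
rewrite (_ : 2 * (uphalf k).+1 = 2 * uphalf k + 2)%N; last by lia.
rewrite exprD /rellich_factor k1 natrM.
by field; rewrite expf_neq0.
Qed.

Lemma hardy_coef_first k : (0 < k)%N -> hardy_coef k 1 = first_const n.+1 k.
Proof.
have nS : n.+1%:R = n_ + 1 by rewrite natr1.
elim/nat_ind2: k => [//| |[|k] IH _].
- by move=> _ /=; rewrite /first_const /= muln0 big_geq//= expr0 expr2; field.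
- by rewrite /= /first_const /= big_nat1 nS ?muln1 ?expr0; field.
rewrite hardy_coefSS1 IH// hardy_coef0 /first_const /= negbK nS addrK; case: ifP => ok.
  have k1 : (k.+1 = 2 * uphalf k + 1)%N.
    by have := odd_double_half k.+1; rewrite /= ok /= uphalfE; lia.
  rewrite k1; move: (uphalf k) => m.
  rewrite [in RHS]big_nat_recr//=.
  rewrite (_ : 4 * m.+1 + 2 = (4 * m + 2) + 4)%N; last by lia.
  rewrite (_ : 2 * m.+1 + 2 * m.+1 - 2 = 4 * m + 2)%N; last by lia.
  rewrite (_ : 2 * (2 * m + 1) = 4 * m + 2)%N; last by lia.
  rewrite [X in _ = _ * (X + _) + _](eq_big_nat _ _ (F2 := fun j : nat =>
      n_ ^+ 2 * n_ ^+ (2 * m + 2 * j - 2))); last first.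
    by move=> j jm; rewrite -exprD; congr (_ ^+ _); lia.
  rewrite -big_distrr /=; move: (\sum_(_ <= _ < _) _) => S.
  rewrite (_ : 2 * m.+1 = 2 * m + 2)%N; last by lia.
  rewrite expr_div_n (exprD 2 (4 * m + 2)) (exprD n_ (2 * m)) mulrA.
  by field; rewrite expf_neq0.
have k1 : (k.+1 = 2 * uphalf k)%N.
  by have := odd_double_half k.+1; rewrite /= ok /= uphalfE; lia.
rewrite k1; move: (uphalf k) => m.
rewrite [in RHS]big_nat_recl//=.
rewrite (_ : 4 * m.+1 - 2 * 1 - 2 = 4 * m)%N; last by lia.
rewrite (_ : 4 * m.+1 = 4 * m + 4)%N; last by lia.
rewrite (_ : 2 * (2 * m) = 4 * m)%N; last by lia.
rewrite [X in _ = _ * (_ + X)](eq_big_nat _ _ (F2 := fun j : nat =>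
    n_ ^+ 2 * n_ ^+ (4 * m - 2 * j - 2))); last first.
  by move=> j jm; rewrite -exprD; congr (_ ^+ _); lia.
rewrite -big_distrr /=; move: (\sum_(_ <= _ < _) _) => S.
rewrite expr_div_n (exprD 2 (4 * m)).
by field; rewrite expf_neq0.
Qed.

Lemma hardy_coef_sumS k (x : R) :
  \sum_(j < k.+3) hardy_coef k.+2 j * x ^+ j =
  hardy_coef k 0 * (n_ ^+ 4 / 16 + n_ * (n_ + 1) / 16 * x
                    + (n_ - 3) ^+ 2 / 16 * x ^+ 2)
  + \sum_(i < k) hardy_coef k i.+1 *
      (n_ ^+ 2 / 16 * x ^+ i.+1 + rellich_factor i.+1 ^+ 2 * x ^+ i.+3).
Proof.
(* both ends agree because the coefficients of index k + 1 and k + 2 vanish *)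
have shift : \sum_(i < k) hardy_coef k i.+1 * x ^+ i.+1 =
    hardy_coef k 1 * x + hardy_coef k 2 * x ^+ 2
    + \sum_(i < k) hardy_coef k i.+3 * x ^+ i.+3.
  transitivity (\sum_(i < k.+2) hardy_coef k i.+1 * x ^+ i.+1).
    by rewrite !big_ord_recr /= !hardy_coef_gt ?mul0r ?addr0.
  by rewrite !big_ord_recl /= addrA expr1.
have tail : \sum_(i < k) hardy_coef k.+2 i.+3 * x ^+ i.+3 =
    n_ ^+ 2 / 16 * \sum_(i < k) hardy_coef k i.+3 * x ^+ i.+3
    + \sum_(i < k) hardy_coef k i.+1 * rellich_factor i.+1 ^+ 2 * x ^+ i.+3.
  rewrite mulr_sumr -big_split; apply: eq_bigr => i _.
  by rewrite hardy_coefSSS /=; ring.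
have rhs : \sum_(i < k) hardy_coef k i.+1 *
      (n_ ^+ 2 / 16 * x ^+ i.+1 + rellich_factor i.+1 ^+ 2 * x ^+ i.+3) =
    n_ ^+ 2 / 16 * \sum_(i < k) hardy_coef k i.+1 * x ^+ i.+1
    + \sum_(i < k) hardy_coef k i.+1 * rellich_factor i.+1 ^+ 2 * x ^+ i.+3.
  rewrite mulr_sumr -big_split; apply: eq_bigr => i _ /=.
  by ring.
rewrite !big_ord_recl /= rhs shift -addrA.
rewrite [X in _ + (_ + (_ + X))](_ : _ =
  \sum_(i < k) hardy_coef k.+2 i.+3 * x ^+ i.+3); last by [].
by rewrite tail; ring.
Qed.

End constants.

Section ray_iteration.
Context {R : realType} (a b : R) (n : nat).
Implicit Types (f : R -> R) (r : R) (k : nat).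

Local Notation n_ := (n%:R : R).

Definition ray_nabla k f r : R :=
  let g := iter k./2 (radial_op n) f in if odd k then derive1 g r else g r.

Lemma ray_nablaSS k f : ray_nabla k.+2 f = ray_nabla k (radial_op n f).
Proof. by rewrite /ray_nabla /= negbK -iterSr. Qed.

Definition hardy_weight k r : R :=
  \sum_(j < k.+1) hardy_coef n k j * (r^-1 ^+ 2) ^+ j.

(** The inequality of order k is applied to the image of f under the radial
operator, and each of its weighted terms is bounded below separately. *)
Lemma hardy_rellich_exact k f : (2 * k <= n)%N -> test_on a b f ->
  le_exact a b (fun r => hardy_weight k r * f r ^+ 2 * sinh r ^+ n)
               (fun r => ray_nabla k f r ^+ 2 * sinh r ^+ n).
Proof.
elim/nat_ind2: k f => [||k IH] f kn tf.
- by apply: le_exact_le => r _; rewrite /hardy_weight big_ord_recl big_ord0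
    expr0 mulr1 addr0 mul1r.
- have [G [tG Gle]] := poincare_hardy_exact kn tf.
  exists G; split=> // r r0; apply: le_trans (Gle r r0).
  rewrite /hardy_weight !big_ord_recl big_ord0 /= expr0 mulr1 addr0 expr1.
  by rewrite (mulrC 4^-1).
have k2 : (2 * k <= n)%N by lia.
rewrite ray_nablaSS; apply: le_exact_trans (IH _ k2 (test_on_radial_op n tf)).
pose h1 i (r : R) := hardy_coef n k i.+1 * ((n_ ^+ 2 / 16 * r^-1 ^+ (2 * i.+1) +
   rellich_factor n i.+1 ^+ 2 * r^-1 ^+ (2 * i.+1 + 4)) * f r ^+ 2 * sinh r ^+ n).
pose h2 i (r : R) := hardy_coef n k i.+1 *
  (r^-1 ^+ (2 * i.+1) * radial_op n f r ^+ 2 * sinh r ^+ n).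
have h12 i : (i < k)%N -> le_exact a b (h1 i) (h2 i).
  move=> ik; apply: le_exactZ; first exact: hardy_coef_ge0.
  by apply: rellich_weighted_exact => //; lia.
have n4 : (4 <= n)%N by lia.
have [G [tG Gle]] := le_exactD
  (le_exactZ (hardy_coef_ge0 n k 0) (rellich_poincare_exact n4 tf))
  (le_exact_sum h12).
exists G; split=> // r r0; move: (Gle r r0).
rewrite /hardy_weight hardy_coef_sumS big_ord_recl expr0 mulr1.
set L := (X in X + _ <= _ -> _); set U := (X in _ <= X -> _).
set L' := (X in _ -> X + _ <= _); set U' := (X in _ -> _ <= X).
have -> : U' = U.
  rewrite /U' /U /h2 2!mulrDl !mulr_suml -!mulrA; congr (_ + _).
  by apply: eq_bigr => i _; rewrite /= -exprM !mulrA.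
suff -> : L' = L by [].
rewrite /L' /L /h1 2!mulrDl !mulr_suml; congr (_ + _).
  by rewrite -exprM !mulrA.
by apply: eq_bigr => i _; rewrite -!exprM (_ : 2 * i.+3 = 2 * i.+1 + 4)%N ?mulrA//; lia.
Qed.

End ray_iteration.

Section ray_integral.
Context {R : realType} (a b : R).
Local Notation mu := (@lebesgue_measure R : set (measurableTypeR R) -> \bar R).
Local Notation D := (`]0%R, +oo[%classic : set (measurableTypeR R)).
Implicit Types (G h : R -> R).

Lemma measurable_smooth_pos h : smooth_pos h -> measurable_fun D h.
Proof.
move=> Ch; apply: open_continuous_measurable_fun; first exact: interval_open.
by move=> r; rewrite inE /= in_itv /= andbT => r0; exact: smooth_pos_continuous.
Qed.

(** The support of G lies in the interior of [a/2, b + 1], so that the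
fundamental theorem of calculus applies with vanishing boundary values. *)
Lemma integral_exact G : 0 < a -> test_on a b G ->
  mu.-integrable D (EFin \o derive1 G) /\
  (\int[mu]_(r in D) (derive1 G r)%:E = 0)%E.
Proof.
move=> a0 [CG sG]; have [ab|ba] := leP a b; last first.
  have G0 r : 0 < r -> derive1 G r = 0.
    move=> r0; apply: (supported_in_derive sG) => //.
    by apply/negP => /andP[/le_trans h /h]; rewrite leNgt ba.
  split; last by apply: integral0_eq => r /=; rewrite in_itv/= andbT => /G0 ->.
  apply: (@eq_integrable _ _ _ mu D _ (cst 0%E)) => //; last exact: integrable0.
  by move=> r; rewrite inE/= in_itv/= andbT => /G0 ->.
pose c := a / 2; pose d := b + 1.
have c0 : 0 < c by rewrite divr_gt0.
have ca : c < a by rewrite /c; lra.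
have cd : c < d by rewrite /d; lra.
pose cd_ := (`[c, d]%classic : set (measurableTypeR R)).
have eqDI : (EFin \o derive1 G) \_ D = (EFin \o derive1 G) \_ cd_.
  apply/funext => r; rewrite !patchE.
  have [rD|rD] := boolP (r \in D); have [rI|rI] := boolP (r \in cd_) => //=.
    move: rD; rewrite inE/= in_itv/= andbT => r0.
    rewrite (supported_in_derive sG)//; apply/negP => /andP[ar rb].
    move/negP: rI; apply; rewrite inE /cd_ /= in_itv/= (le_trans (ltW ca) ar)/=.
    by rewrite (le_trans rb)// /d lerDl.
  move: rI; rewrite inE /cd_ /= in_itv/= => /andP[cr _].
  by move/negP: rD; case; rewrite inE/= in_itv/= andbT (lt_le_trans c0).
have cG1 : {within `[c, d], continuous (derive1 G)}.
  apply: continuous_in_subspaceT => r; rewrite inE/= in_itv/= => /andP[cr _].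
  by apply: smooth_pos_continuous; [exact: smooth_pos_derive|exact: lt_le_trans cr].
have dG : derivable_oo_LRcontinuous G c d.
  split=> [r||].
  - rewrite in_itv/= => /andP[cr _].
    by have [] := smooth_pos_is_derive CG (lt_trans c0 cr).
  - by apply: cvg_at_right_filter; exact: smooth_pos_continuous.
  - apply: cvg_at_left_filter; apply: smooth_pos_continuous => //.
    exact: lt_trans cd.
have iI : mu.-integrable `[c, d] (EFin \o derive1 G).
  by apply: continuous_compact_integrable; [exact: segment_compact|exact: cG1].
split.
  have mD : measurable D by [].
  have mI : measurable (`[c, d]%classic : set (measurableTypeR R)) by [].
  by apply/(integrable_mkcond _ mD); rewrite eqDI; apply/(integrable_mkcond _ mI).
rewrite integral_mkcond [X in (\int[_]_x X x)%E]eqDI -integral_mkcond.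
have Gc : G c = 0 by apply: sG => //; rewrite negb_and -!ltNge ca.
have Gd : G d = 0.
  by apply: sG; rewrite ?(lt_trans c0 cd)// negb_and -!ltNge ltrDl ltr01 orbT.
by rewrite (continuous_FTC2 cd cG1 dG (fun _ _ => erefl)) Gc Gd subee.
Qed.

(** When the integral of h2 is finite, h2 - G' is integrable with the same
integral, and it dominates h1. *)
Lemma le_exact_integral h1 h2 : 0 < a -> le_exact a b h1 h2 ->
  measurable_fun D h1 -> measurable_fun D h2 ->
  (forall r, 0 < r -> 0 <= h1 r) -> (forall r, 0 < r -> 0 <= h2 r) ->
  (\int[mu]_(r in D) (h1 r)%:E <= \int[mu]_(r in D) (h2 r)%:E)%E.
Proof.
move=> a0 [G [tG Gle]] m1 m2 h10 h20.
have D0 r : D r -> 0 < r by rewrite /= in_itv/= andbT.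
have [iG G0] := integral_exact a0 tG.
have i20 : (0 <= \int[mu]_(r in D) (h2 r)%:E)%E.
  by apply: integral_ge0 => r /D0 /h20; rewrite lee_fin.
have [->|i2] := eqVneq (\int[mu]_(r in D) (h2 r)%:E)%E +oo%E; first exact: leey.
have i2' : mu.-integrable D (EFin \o h2).
  apply/integrableP; split; first exact/measurable_EFinP.
  rewrite [ltLHS](_ : _ = \int[mu]_(r in D) (h2 r)%:E)%E ?ltey//.
  by apply: eq_integral => r; rewrite inE => /D0 /h20 h2r; rewrite /= ger0_norm.
rewrite -[leRHS]sube0 -G0 -integralB_EFin//.
apply: ge0_le_integral => //.
- by move=> r /D0 /h10; rewrite lee_fin.
- exact/measurable_EFinP.
- apply/measurable_EFinP/measurable_funB => //.
  by apply: measurable_smooth_pos; apply: smooth_pos_derive; have [] := tG.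
- by move=> r /D0 r0; rewrite -EFinB lee_fin; have := Gle r r0; lra.
Qed.

End ray_integral.

(** * Restriction of a smooth function of several variables to a line *)

Section lines.
Context {R : realType} {N : nat}.
Implicit Types (u v : 'rV[R]_N -> R) (x y e z : 'rV[R]_N) (s t r : R).

Let growth_line u y e s :
  (fun h : R => h^-1 *: (((fun t => u (y + t *: e)) \o shift s) (h *: 1)
                         - u (y + s *: e))) =
  (fun h : R => h^-1 *: ((u \o shift (y + s *: e)) (h *: e) - u (y + s *: e))).
Proof.
apply/funext => h; congr (_ *: (_ - _)); rewrite /= /shift /=; congr u.
by rewrite [h *: 1]mulr1 scalerDl addrCA.
Qed.

Lemma derivable_line u y e s :
  derivable u (y + s *: e) e <-> derivable (fun t => u (y + t *: e)) s 1.
Proof. by rewrite /derivable growth_line. Qed.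

Lemma derive_line u y e s :
  'D_e u (y + s *: e) = derive1 (fun t => u (y + t *: e)) s.
Proof. by rewrite derive1E /derive growth_line. Qed.

Lemma is_derive_line u y e s : derivable u (y + s *: e) e ->
  is_derive s 1 (fun t => u (y + t *: e)) ('D_e u (y + s *: e)).
Proof.
move=> /derivable_line du; rewrite derive_line derive1E; exact: derivableP.
Qed.

Lemma mvt_from0 (f df : R -> R) t : (forall s, is_derive s 1 f (df s)) ->
  exists2 c, `|c| <= `|t| & f t - f 0 = df c * t.
Proof.
move=> fdf; have cf i : {within i, continuous f}.
  apply: continuous_subspaceT => s.
  by apply/differentiable_continuous/derivable1_diffP; case: (fdf s).
have [t0|t0] := leP 0 t.
  have [c] := MVT_segment t0 (fun s _ => fdf s) (cf _).
  rewrite in_itv/= subr0 => /andP[c0 ct] ->; exists c => //.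
  by rewrite !ger0_norm.
have [c] := MVT_segment (ltW t0) (fun s _ => fdf s) (cf _).
rewrite in_itv/= sub0r => /andP[tc c0] E; exists c.
  by rewrite (ltr0_norm t0) ler0_norm// lerN2.
by rewrite -opprB E mulrN opprK.
Qed.

Lemma entry_le_norm z (i : 'I_N) : `|z 0 i| <= `|z|.
Proof.
rewrite [leRHS]mx_normrE.
exact: (le_bigmax _ (fun ij : 'I_1 * 'I_N => `|z ij.1 ij.2|) (0, i)).
Qed.

Lemma norm_le_entries z c : 0 <= c -> (forall i, `|z 0 i| <= c) -> `|z| <= c.
Proof.
move=> c0 zc; rewrite [leLHS]mx_normrE; apply: bigmax_le => //= -[j i] _ /=.
by rewrite (ord1 j).
Qed.

(** Moving from x to x + z one coordinate at a time, each step is controlled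
by the mean value theorem in that coordinate. *)
Lemma increment_le u x z (eps delta : R) :
  (forall i y, derivable u y (delta_mx 0 i)) ->
  (forall i y, `|y - x| < delta -> `|partial i u y - partial i u x| <= eps) ->
  `|z| < delta ->
  `|u (x + z) - u x - \sum_i z 0 i * partial i u x| <= eps * \sum_i `|z 0 i|.
Proof.
move=> du dclose zd.
pose tr m : 'rV[R]_N := \row_i (if (i < m)%N then z 0 i else 0).
have tr0 : tr 0%N = 0 by apply/rowP => i; rewrite !mxE.
have trN : tr N = z by apply/rowP => i; rewrite !mxE ltn_ord.
have trS (i : 'I_N) : tr i.+1 = tr i + z 0 i *: delta_mx 0 i.
  apply/rowP => j; rewrite !mxE /= ltnS leq_eqVlt.
  have [->|ji] := eqVneq j i; first by rewrite eqxx ltnn /= mulr1 add0r.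
  by rewrite -val_eqE /= in ji; rewrite (negPf ji) /= mulr0 addr0.
have step (i : 'I_N) : `|u (x + tr i.+1) - u (x + tr i) - z 0 i * partial i u x|
    <= eps * `|z 0 i|.
  have [|c cz] := @mvt_from0 (fun t => u ((x + tr i) + t *: delta_mx 0 i))
    (fun t => partial i u ((x + tr i) + t *: delta_mx 0 i)) (z 0 i).
    by move=> s; apply: is_derive_line.
  rewrite scale0r addr0 trS addrA => ->.
  rewrite [X in X - _]mulrC -mulrBr normrM mulrC ler_wpM2r//.
  apply: dclose; apply: le_lt_trans zd.
  apply: norm_le_entries => // j; rewrite !mxE /= addrAC [x 0 j + _]addrC addrK.
  have [->|ji] := eqVneq j i.
    by rewrite ltnn add0r mulr1 (le_trans cz)// entry_le_norm.
  rewrite mulr0 addr0; case: ifP => _; last by rewrite normr0.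
  exact: entry_le_norm.
have -> : u (x + z) - u x = \sum_(i < N) (u (x + tr i.+1) - u (x + tr i)).
  have := telescope_sumr (fun m => u (x + tr m)) (leq0n N).
  by rewrite trN tr0 addr0 big_mkord => ->.
rewrite -sumrB mulr_sumr; apply: (le_trans (ler_norm_sum _ _ _)).
by apply: ler_sum => i _; exact: step.
Qed.

(** With eps tending to 0, the previous estimate says that the increment along the
ray is linear in h up to o(h). *)
Lemma is_derive_ray u x s :
  (forall i y, derivable u y (delta_mx 0 i)) ->
  (forall i, continuous (partial i u)) ->
  is_derive s 1 (fun t => u (t *: x)) (\sum_i x 0 i * partial i u (s *: x)).
Proof.
move=> du cu; set L := \sum_i _.
suff cvgL : (fun h : R => h^-1 *: (((fun t => u (t *: x)) \o shift s) (h *: 1)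
                                 - u (s *: x))) @ 0^' --> L.
  by apply: DeriveDef; [apply/cvg_ex; exists L|exact: cvg_lim].
apply/cvgrPdist_le => e e0.
pose S := \sum_i `|x 0 i|; have S0 : 0 <= S by apply: sumr_ge0.
pose eps := e / (1 + S).
have eps0 : 0 < eps by rewrite divr_gt0// ltr_pwDl.
have [delta d0 Hd] : exists2 delta : R, 0 < delta & forall i y,
    `|y - s *: x| < delta -> `|partial i u y - partial i u (s *: x)| <= eps.
  have : \forall y \near s *: x, forall i,
      `|partial i u y - partial i u (s *: x)| <= eps.
    suff : forall i, \forall y \near s *: x,
      `|partial i u y - partial i u (s *: x)| <= eps.
      move=> H; apply: (@filter_forall _ _ (fun i y =>
        `|partial i u y - partial i u (s *: x)| <= eps)) H.
    move=> i.
    have /cvgrPdist_le /(_ _ eps0) := cu i (s *: x).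
    by apply: filterS => y; rewrite distrC.
  move=> /nbhs_ballP[delta /= d0 H]; exists delta => // i y yd.
  by apply: H; rewrite mx_norm_ball /ball_ /= distrC.
near=> h.
have h0 : h != 0 by near: h; exact: nbhs_dnbhs_neq.
have hx : `|h *: x| < delta.
  have : `|h| * (1 + `|x|) < delta.
    rewrite -ltr_pdivlMr ?ltr_pwDl//; near: h.
    by apply: dnbhs0_lt; rewrite divr_gt0// ltr_pwDl.
  by apply: le_lt_trans; rewrite normrZ ler_wpM2l// lerDr.
have := increment_le du Hd hx.
rewrite /= /shift /= [h *: 1]mulr1 (addrC h s) scalerDl => H.
have hn : 0 < `|h| by rewrite normr_gt0.
have sum1 : \sum_i (h *: x) 0 i * partial i u (s *: x) = h * L.
  by rewrite mulr_sumr; apply: eq_bigr => i _; rewrite mxE mulrA.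
have sum2 : \sum_i `|(h *: x) 0 i| = `|h| * S.
  by rewrite mulr_sumr; apply: eq_bigr => i _; rewrite mxE normrM.
rewrite sum1 sum2 in H.
rewrite -(ler_pM2l hn) -normrM mulrBr /GRing.scale /= mulrA mulfV// mul1r distrC.
apply: (le_trans H); rewrite mulrCA ler_wpM2l//.
by rewrite /eps -mulrA ler_piMr ?(ltW e0)// mulrC ler_pdivrMr ?mul1r ?lerDr// ltr_pwDl.
Unshelve. all: by end_near.
Qed.

End lines.

(** * Radial operators along a ray *)

Section rays.
Context {R : realType}.

(** The derivative of u along the ray is a combination of restrictions of the
partial derivatives of u, which are smooth again. *)
Lemma smooth_ray (N : nat) (u : 'rV[R]_N -> R) (x : 'rV[R]_N) : smooth u ->
  smooth_pos (fun t => u (t *: x)).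
Proof.
move=> su m; elim: m u su => // m IH u su.
have sp i : smooth (partial i u) by move=> k; have [_ /(_ i)[]] := su k.+1.
have sumC (I : Type) (s : seq I) (F : I -> R -> R) : (forall i, Cn_pos m (F i)) ->
    Cn_pos m (fun t => \sum_(i <- s) F i t).
  move=> CF; elim: s => [|i s IHs].
    by apply: Cn_pos_eq (Cn_pos_cst m 0) => r _; rewrite big_nil.
  by apply: Cn_pos_eq (Cn_posD (CF i) IHs) => r _; rewrite big_cons.
exists (fun t => \sum_i x 0 i * partial i u (t *: x)).
  move=> r _; apply: is_derive_ray => i; first by have [_ /(_ i)[]] := su 1%N.
  by have [] := sp i 0%N.
by apply: sumC => i; apply: Cn_posM; [exact: Cn_pos_cst|exact: IH].
Qed.

Context {n : nat}.
Local Notation N := n.+1.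
Implicit Types (u v : 'rV[R]_N -> R) (x : 'rV[R]_N) (s t r : R).

Lemma enorm_scale x s : 0 <= s -> enorm (s *: x) = s * enorm x.
Proof.
move=> s0; rewrite /enorm.
have -> : \sum_i (s *: x) 0 i ^+ 2 = s ^+ 2 * \sum_i x 0 i ^+ 2.
  by rewrite mulr_sumr; apply: eq_bigr => i _; rewrite mxE exprMn.
by rewrite sqrtrM ?sqr_ge0// sqrtr_sqr ger0_norm.
Qed.

Lemma enorm_ray x s : enorm x = 1 -> 0 <= s -> enorm (s *: x) = s.
Proof. by move=> x1 s0; rewrite enorm_scale// x1 mulr1. Qed.

(** The unit vector x / |x| is constant along a ray, so dr v only sees the
restriction of v to it; this is what lets the iterates of the radial Laplacian be
computed on the half-line. *)
Lemma dr_ray v x s : enorm x = 1 -> 0 < s ->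
  dr v (s *: x) = derive1 (fun t => v (t *: x)) s.
Proof.
move=> x1 s0; rewrite /dr (enorm_ray x1 (ltW s0)) scalerA mulVf ?gt_eqF// scale1r.
have := derive_line v 0 x s; rewrite add0r => ->.
by congr (derive1 _ s); apply/funext => t; rewrite add0r.
Qed.

Lemma radial_laplacian_ray v x s : enorm x = 1 -> 0 < s ->
  radial_laplacian v (s *: x) = radial_op n (fun t => v (t *: x)) s.
Proof.
move=> x1 s0.
have E : derive1 (fun t => dr v (t *: x)) s = derive1 (derive1 (fun t => v (t *: x))) s.
  by apply: (derive1_eq_pos s0) => t t0; exact: dr_ray.
rewrite /radial_laplacian (dr_ray (dr v) x1 s0) E (dr_ray v x1 s0).
by rewrite (enorm_ray x1 (ltW s0)) -(natr1 n) addrK.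
Qed.

Lemma iter_radial_laplacian_ray j u x s : enorm x = 1 -> 0 < s ->
  iter j (@radial_laplacian R N) u (s *: x) =
  iter j (radial_op n) (fun t => u (t *: x)) s.
Proof.
move=> x1; elim: j s => // j IH s s0.
rewrite iterS radial_laplacian_ray// iterS.
exact: radial_op_eq.
Qed.

Lemma nabla_ray k u x s : enorm x = 1 -> 0 < s ->
  nabla_r_sq k u (s *: x) = ray_nabla n k (fun t => u (t *: x)) s ^+ 2.
Proof.
move=> x1 s0; rewrite /nabla_r_sq /ray_nabla; case: ifP => _; congr (_ ^+ 2).
  rewrite dr_ray//; apply: (derive1_eq_pos s0) => t t0.
  exact: iter_radial_laplacian_ray.
exact: iter_radial_laplacian_ray.
Qed.

End rays.

(** * Measurability in polar coordinates *)

Section measurability.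
Context {R : realType}.
Local Notation mR := (measurableTypeR R).

(** Open sets of R^N are countable unions of boxes with rational centres. *)
Lemma measurable_continuous_rV (d : measure_display) (T : measurableType d)
    (N : nat) (D : set T) (phi : T -> 'rV[R]_N) (u : 'rV[R]_N -> R) :
  measurable D -> continuous u ->
  (forall i, measurable_fun D (fun p => phi p 0 i)) ->
  measurable_fun D (fun p => u (phi p)).
Proof.
move=> mD cu mphi.
apply: (measurability _ (RGenOpens.measurableE R)) => _ [_ [a [b ->]] <-].
set O := u @^-1` `]a, b[%classic.
have oO : open O by apply: open_comp; [move=> x _; exact: cu|exact: interval_open].
pose box (q : 'rV[rat]_N * nat) : set 'rV[R]_N :=
  [set x | forall i, `|x 0 i - ratr (q.1 0 i)| < q.2.+1%:R^-1].
have OE : O = \bigcup_(q in [set q | box q `<=` O]) box q.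
  apply/seteqP; split=> [x Ox|x [q qO]]; last exact: qO.
  have /nbhs_ballP[e /= e0 xe] : nbhs x O by exact: open_nbhs_nbhs.
  have [m me] : exists m, 2 * m.+1%:R^-1 < e.
    have e2 : 0 < e / 2 by rewrite divr_gt0.
    have [m _ Hm] := near_infty_natSinv_lt (PosNum e2).
    by exists m; have := Hm m (leqnn m); rewrite /= ltr_pdivlMr// mulrC.
  set del := m.+1%:R^-1 in me.
  have del0 : 0 < del by rewrite invr_gt0.
  have /choice[q Hq] : forall i, exists q : rat, `|x 0 i - ratr q| < del.
    move=> i; have /rat_in_itvoo[q] : x 0 i - del < x 0 i + del by lra.
    by rewrite in_itv/= => /andP[? ?]; exists q; rewrite ltr_distl; lra.
  exists (\row_i q i, m) => /=; last by move=> i; rewrite /= mxE.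
  move=> y yq; apply: xe; rewrite mx_norm_ball /ball_ /=.
  apply: le_lt_trans me; apply: norm_le_entries => [|i]; first by lra.
  rewrite !mxE; have := yq i; rewrite /= mxE -/del => yi; have xi := Hq i.
  rewrite (_ : _ - _ = (x 0 i - ratr (q i)) - (y 0 i - ratr (q i))); last by ring.
  by apply: (le_trans (ler_normB _ _)); lra.
have -> : D `&` (fun p => u (phi p)) @^-1` `]a, b[%classic = D `&` phi @^-1` O by [].
rewrite OE preimage_bigcup setI_bigcupr bigcup_mkcond.
apply: countable_bigcupT_measurable; first exact: countableP.
move=> q; case: ifP => // _.
have -> : D `&` phi @^-1` box q = D `&` \bigcap_(i in [set: 'I_N])
    (D `&` (fun p => phi p 0 i) @^-1`
       `](ratr (q.1 0 i) - q.2.+1%:R^-1), (ratr (q.1 0 i) + q.2.+1%:R^-1)[%classic).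
  apply/seteqP; split=> p [Dp pq]; split=> // i.
    by move=> _; split=> //; have := pq i; rewrite /= in_itv/= ltr_distl.
  by have [_] := pq i I; rewrite /= in_itv/= -ltr_distl.
apply: measurableI => //; apply: fin_bigcap_measurable => // i _.
exact: mphi.
Qed.

End measurability.

Section polar.
Context {R : realType} {n : nat}.
Local Notation mR := (measurableTypeR R).
Local Notation N := n.+1.
Local Notation D := (`]0%R, +oo[%classic : set mR).
Local Notation S := (@unit_sphere R N).
Local Notation polar := (fun p : mR * N.-tuple mR => p.1 *: Defs.point p.2).
Implicit Types (u v : 'rV[R]_N -> R) (x : 'rV[R]_N) (s t r : R).

Lemma half_lineE r : D r -> 0 < r.
Proof. by rewrite /= in_itv/= andbT. Qed.

Lemma measurable_unit_sphere : measurable S.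
Proof.
have := @measurable_enorm R N measurableT [set 1] (measurable_set1 1).
by rewrite setTI.
Qed.

Lemma measurable_polar_set : measurable (D `*` S).
Proof. by apply: measurableX => //; exact: measurable_unit_sphere. Qed.

Lemma measurable_smooth_radius (h : R -> R) : smooth_pos h ->
  measurable_fun (D `*` S) (fun p => h p.1).
Proof.
move=> /measurable_smooth_pos mh.
apply: (measurable_comp (F := D)) => //; first by move=> _ [p [pD _] <-].
by apply: measurable_funTS.
Qed.

Lemma measurable_polar u : continuous u ->
  measurable_fun setT (fun p => u (polar p)).
Proof.
move=> cu; apply: measurable_continuous_rV => // i.
rewrite (_ : (fun _ => _) = fun p : mR * N.-tuple mR => p.1 * tnth p.2 i).
  apply: measurable_funM => //.
  by apply: (measurableT_comp (measurable_tnth _)).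
by apply/funext => p; rewrite !mxE.
Qed.

Definition ray_smooth v := forall x, enorm x = 1 ->
  smooth_pos (fun t => v (t *: x)).

Lemma ray_smooth_dr v : ray_smooth v -> ray_smooth (dr v).
Proof.
move=> sv x x1; apply: smooth_pos_eq (smooth_pos_derive (sv x x1)) => s s0.
by rewrite dr_ray.
Qed.

Lemma ray_smooth_radial_laplacian v : ray_smooth v ->
  ray_smooth (radial_laplacian v).
Proof.
move=> sv x x1; have C1 := smooth_pos_derive (sv x x1).
have H : smooth_pos (radial_op n (fun t => v (t *: x))).
  apply: smooth_posD; first exact: smooth_pos_derive.
  by do 2?apply: smooth_posM => //; [exact: smooth_pos_cst|exact: smooth_pos_coth].
by apply: smooth_pos_eq H => s s0; rewrite radial_laplacian_ray.
Qed.

(** The radial derivative is a pointwise limit of difference quotients along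
rays. *)
Lemma measurable_dr v : ray_smooth v ->
  measurable_fun (D `*` S) (fun p => v (polar p)) ->
  measurable_fun (D `*` S) (fun p => dr v (polar p)).
Proof.
move=> sv mv.
pose h (m : nat) (p : mR * N.-tuple mR) : R :=
  m.+1%:R * (v ((p.1 + m.+1%:R^-1) *: Defs.point p.2) - v (polar p)).
apply: (measurable_fun_cvg (h := h)) => [m|[r t] [/half_lineE /= r0 /= t1]].
  apply: measurable_funM => //; apply: measurable_funB => //.
  pose sh (p : mR * N.-tuple mR) : mR * N.-tuple mR := (p.1 + m.+1%:R^-1, p.2).
  apply: (measurable_comp (F := D `*` S) (g := sh)
    (f := fun p => v (polar p))) => //; first exact: measurable_polar_set.
    move=> _ [[r t] [/half_lineE /= r0 rt] <-]; split=> //=.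
    by rewrite in_itv/= andbT addr_gt0// invr_gt0.
  apply: measurable_funTS; apply/measurable_fun_pair; last exact: measurable_snd.
  by apply: (measurable_funD measurable_fst).
rewrite dr_ray//; have [dv _] := smooth_pos_is_derive (sv _ t1) r0.
rewrite derive1E /derive.
have := dv => /cvg_ex[/= l dl]; rewrite (cvg_lim _ dl)//.
move/cvgr_dnbhsP : dl => /(_ (fun m => m.+1%:R^-1)).
have H1 : (forall m : nat, (m.+1%:R^-1 : R) != 0) by move=> m; rewrite invr_eq0 pnatr_eq0.
have H2 : (m.+1%:R^-1 : R) @[m --> \oo] --> (0 : R) by exact: cvg_harmonic.
move=> /(_ (conj H1 H2)); apply: cvg_trans; apply: near_eq_cvg; near=> m.
by rewrite /h /= invrK /shift /= [_ *: 1]mulr1 (addrC r).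
Unshelve. all: by end_near.
Qed.

Lemma measurable_radial_laplacian v : ray_smooth v ->
  measurable_fun (D `*` S) (fun p => v (polar p)) ->
  measurable_fun (D `*` S) (fun p => radial_laplacian v (polar p)).
Proof.
move=> sv mv; have m1 := measurable_dr sv mv.
have m2 := measurable_dr (ray_smooth_dr sv) m1.
apply: measurable_funD => //; apply: measurable_funM => //.
apply: measurable_funM => //.
apply: (eq_measurable_fun (fun p => coth p.1)); last first.
  exact: (measurable_smooth_radius smooth_pos_coth).
by move=> [r t]; rewrite inE => -[/half_lineE /= r0 t1] /=; rewrite (enorm_ray t1 (ltW r0)).
Qed.

Lemma measurable_nabla k u : smooth u ->
  measurable_fun (D `*` S) (fun p => nabla_r_sq k u (polar p)).
Proof.
move=> su; have cu : continuous u by have [] := su 0%N.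
have H j : ray_smooth (iter j (@radial_laplacian R N) u) /\
    measurable_fun (D `*` S) (fun p => iter j (@radial_laplacian R N) u (polar p)).
  elim: j => [|j [IH1 IH2]].
    split; first by move=> x _; exact: smooth_ray.
    by apply: measurable_funTS; exact: measurable_polar.
  by split; [exact: ray_smooth_radial_laplacian|exact: measurable_radial_laplacian].
have [sv mv] := H k./2; rewrite /nabla_r_sq; case: (odd k).
  by apply: measurable_funX; exact: measurable_dr.
exact: measurable_funX.
Qed.

End polar.

(** * From rays to hyperbolic space *)

Section integration.
Context {R : realType} {n : nat}.
Local Notation mR := (measurableTypeR R).
Local Notation N := n.+1.
Local Notation D := (`]0%R, +oo[%classic : set mR).
Local Notation S := (@unit_sphere R N).
Local Notation mu := (@lebesgue_measure R : set mR -> \bar R).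
Local Notation sg := (@sphere_measure R N).
Local Notation polar := (fun p : mR * N.-tuple mR => p.1 *: Defs.point p.2).
Implicit Types (f g u : 'rV[R]_N -> R) (x : 'rV[R]_N) (s t r : R).

Let integrand f (p : mR * N.-tuple mR) : R := f (polar p) * sinh p.1 ^+ n.

Let measurable_integrand f :
  measurable_fun (D `*` S) (fun p => f (polar p)) ->
  measurable_fun (D `*` S) (EFin \o integrand f).
Proof.
move=> mf; apply/measurable_EFinP; apply: measurable_funM => //.
exact: (measurable_smooth_radius (smooth_posX n smooth_pos_sinh)).
Qed.

Let integrand_ge0 f : (forall x, 0 <= f x) ->
  forall p, (D `*` S) p -> (0 <= (integrand f p)%:E)%E.
Proof.
move=> f0 [r t] [/half_lineE /= r0 _]; rewrite lee_fin mulr_ge0//.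
by rewrite exprn_ge0// ltW// sinh_gt0.
Qed.

Lemma hyp_integral_tonelli f : (forall x, 0 <= f x) ->
  measurable_fun (D `*` S) (fun p => f (polar p)) ->
  hyp_integral f = (\int[sg]_(t in S) \int[mu]_(r in D)
    (f (r *: Defs.point t) * sinh r ^+ n)%:E)%E.
Proof.
move=> f0 mf; rewrite /hyp_integral -/(integrand f) integral_mkcond.
rewrite fubini_tonelli2.
- rewrite [RHS]integral_mkcond; apply: eq_integral => t _.
  rewrite /fubini_G patchE; case: ifPn => tS.
    rewrite [RHS]integral_mkcond; apply: eq_integral => r _.
    by rewrite !patchE in_setX tS andbT.
  by apply: integral0_eq => r _; rewrite patchE in_setX (negPf tS) andbF.
- apply/(measurable_restrict _ _ _).1 => //; first exact: measurable_polar_set.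
  by rewrite setTI; exact: measurable_integrand.
- by move=> p; rewrite patchE; case: ifP => //; rewrite inE => /(integrand_ge0 f0).
Qed.

(** Monotonicity of the integral over the sphere applies because the inner
integrals are measurable there, by the Fubini-Tonelli construction. *)
Lemma hyp_integral_le f g : (forall x, 0 <= f x) -> (forall x, 0 <= g x) ->
  measurable_fun (D `*` S) (fun p => f (polar p)) ->
  measurable_fun (D `*` S) (fun p => g (polar p)) ->
  (forall x, enorm x = 1 ->
    (\int[mu]_(r in D) (f (r *: x) * sinh r ^+ n)%:E <=
     \int[mu]_(r in D) (g (r *: x) * sinh r ^+ n)%:E)%E) ->
  (hyp_integral f <= hyp_integral g)%E.
Proof.
move=> f0 g0 mf mg fg; rewrite !hyp_integral_tonelli//.
have mG (h : 'rV[R]_N -> R) : (forall x, 0 <= h x) ->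
    measurable_fun (D `*` S) (fun p => h (polar p)) ->
    measurable_fun S (fun t : N.-tuple mR =>
      \int[mu]_(r in D) (h (r *: Defs.point t) * sinh r ^+ n)%:E)%E.
  move=> h0 mh.
  have := @measurable_fun_fubini_tonelli_G _ _ _ _ _ mu
    ((EFin \o integrand h) \_ (D `*` S)).
  rewrite /fubini_G => H.
  apply: (eq_measurable_fun (fun t : N.-tuple mR =>
      \int[mu]_r ((EFin \o integrand h) \_ (D `*` S)) (r, t))%E).
    move=> t tS; rewrite [RHS]integral_mkcond; apply: eq_integral => r _.
    by rewrite !patchE in_setX tS andbT.
  apply: measurable_funTS; apply: H.
    apply/(measurable_restrict _ _ _).1 => //; first exact: measurable_polar_set.
    by rewrite setTI; exact: measurable_integrand.
  by move=> p; rewrite patchE; case: ifP => //; rewrite inE => /(integrand_ge0 h0).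
apply: ge0_le_integral.
- exact: measurable_unit_sphere.
- move=> t _; apply: integral_ge0 => r /half_lineE r0.
  by rewrite lee_fin mulr_ge0// exprn_ge0// ltW// sinh_gt0.
- exact: mG.
- exact: mG.
- by move=> t tS; apply: fg.
Qed.

Let sqr_le_of_norm (y c : R) : `|y| <= c -> y ^+ 2 <= c ^+ 2.
Proof.
move=> yc; rewrite -(real_normK (num_real y)) ler_pXn2r// nnegrE//.
exact: le_trans yc.
Qed.

(** The bounds are uniform over the sphere: a comes from the support avoiding the
pole, b and M from its compactness. *)
Lemma test_function_bounds u : test_function u ->
  exists a b M : R, [/\ 0 < a, 0 < b,
    forall x r, enorm x = 1 -> 0 < r -> ~~ (a <= r <= b) -> u (r *: x) = 0 &
    forall x, `|u x| <= M].
Proof.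
move=> [su ksu s0]; have cu : continuous u by have [] := su 0%N.
have supp x : u x != 0 -> Defs.support u x by move=> ux; exact: subset_closure.
have [e e0 ue] : exists2 e : R, 0 < e & forall x, `|x| < e -> u x = 0.
  have oS : open (~` Defs.support u) by rewrite openC; exact: closed_closure.
  have /nbhs_ballP[e /= e0 xe] : nbhs (0 : 'rV[R]_N) (~` Defs.support u).
    exact: open_nbhs_nbhs.
  exists e => // x xe'; apply/eqP; apply/negPn/negP => /supp.
  by apply: xe; rewrite mx_norm_ball /ball_ /= sub0r normrN.
have [B [_ HB]] := compact_bounded ksu.
have [C [_ HC]] := compact_bounded (continuous_compact (continuous_subspaceT cu) ksu).
pose b0 := `|B| + 1; pose M := `|C| + 1.
have supb x : Defs.support u x -> `|x| <= b0.
  by apply: HB; rewrite /b0 (le_lt_trans (ler_norm B))// ltrDl.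
have uM x : `|u x| <= M.
  have [->|ux] := eqVneq (u x) 0; first by rewrite normr0 addr_ge0.
  apply: (HC M); last by exists x => //; exact: supp.
  by rewrite /M (le_lt_trans (ler_norm C))// ltrDl.
exists e, (N%:R * b0), M; split=> // [|x r x1 r0].
  by rewrite mulr_gt0// ltr_pwDr.
have en := enorm_ray x1 (ltW r0).
rewrite negb_and -!ltNge => /orP[re|br].
  apply: ue; apply: le_lt_trans re; rewrite -{2}en.
  apply: norm_le_entries => [|i]; first exact: sqrtr_ge0.
  rewrite -sqrtr_sqr ler_sqrt ?sumr_ge0// => [|j _]; last exact: sqr_ge0.
  by rewrite (bigD1 i)//= lerDl sumr_ge0// => j _; exact: sqr_ge0.
apply/eqP; apply/negPn/negP => /supp/supb rb; move: br; apply/negP; rewrite -leNgt.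
have b00 : 0 <= N%:R * b0 by rewrite mulr_ge0// addr_ge0.
rewrite -en -(@ler_pXn2r _ 2%N) ?nnegrE ?sqrtr_ge0//.
rewrite sqr_sqrtr; last by apply: sumr_ge0 => j _; exact: sqr_ge0.
apply: (@le_trans _ _ (\sum_(i < N) b0 ^+ 2)).
  apply: ler_sum => i _; apply: sqr_le_of_norm.
  by apply: le_trans rb; exact: entry_le_norm.
rewrite sumr_const card_ord -(mulr_natl (b0 ^+ 2)) exprMn.
by apply: ler_wpM2r; [exact: sqr_ge0|rewrite expr2 ler_peMr// ler1n].
Qed.

(** Finiteness is what allows the Poincare term to be moved to the other side of
the inequality in the extended reals. *)
Lemma hyp_integral_sqr_fin u : test_function u ->
  (hyp_integral (fun x => u x ^+ 2)%R < +oo)%E.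
Proof.
move=> tu; have [a [b [M [a0 b0 uab uM]]]] := test_function_bounds tu.
have cu : continuous u by have [su _ _] := tu; have [] := su 0%N.
have mu2 : measurable_fun (D `*` S) (fun p => u (polar p) ^+ 2).
  by apply: measurable_funX; apply: measurable_funTS; exact: measurable_polar.
pose E : set (mR * N.-tuple mR) := `]0, b]%classic `*` S.
pose K : R := M ^+ 2 * sinh b ^+ n.
have K0 : 0 <= K by rewrite mulr_ge0 ?sqr_ge0// exprn_ge0// ltW// sinh_gt0.
have mE : measurable E by apply: measurableX => //; exact: measurable_unit_sphere.
apply: (@le_lt_trans _ _ (\int[mu \x sg]_(p in D `*` S) ((cst K%:E) \_ E) p)%E).
  apply: ge0_le_integral.
  - exact: measurable_polar_set.
  - exact: (@integrand_ge0 (fun x => u x ^+ 2) (fun x => sqr_ge0 _)).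
  - exact: (@measurable_integrand (fun x => u x ^+ 2) mu2).
  - by apply: measurable_funTS; apply/(measurable_restrict _ _ _).1.
  move=> [r t] [/half_lineE /= r0 t1]; rewrite patchE.
  case: ifPn => [rb|rE].
    move: rb; rewrite inE => -[/=]; rewrite in_itv/= => /andP[_ rb] _.
    have s0 := ltW (sinh_gt0 r0); have sb0 := ltW (sinh_gt0 b0).
    rewrite lee_fin /K; apply: ler_pM; rewrite ?sqr_ge0 ?exprn_ge0//=.
      exact: sqr_le_of_norm.
    by rewrite lerXn2r// ler_pM2r// lerB// ler_expR// lerN2.
  have u0 : u (r *: Defs.point t) = 0.
    apply: uab => //; apply/negP => /andP[_ rb].
    by move/negP: rE; apply; rewrite inE; split=> //=; rewrite in_itv/= r0.
  by rewrite /= u0 expr0n mul0r.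
rewrite -integral_mkcondr integral_cst; last first.
  by apply: measurableI => //; exact: measurable_polar_set.
apply: lte_mul_pinfty => //.
apply: (@le_lt_trans _ _ ((mu \x sg) E)%E).
  apply: le_measure; rewrite ?inE//.
  by apply: measurableI => //; exact: measurable_polar_set.
rewrite product_measure1E//; last exact: measurable_unit_sphere.
apply: lte_mul_pinfty; first exact: measure_ge0.
  by rewrite /= lebesgue_measure_itv/= lte_fin b0 -EFinB.
by rewrite -ge0_fin_numE ?measure_ge0// fin_num_measure//; exact: measurable_unit_sphere.
Qed.


Let measurable_sqr_div j u : smooth u ->
  measurable_fun (D `*` S) (fun p => u (polar p) ^+ 2 / enorm (polar p) ^+ (2 * j)).
Proof.
move=> su; have cu : continuous u by have [] := su 0%N.
apply: (eq_measurable_fun (fun p : mR * N.-tuple mR =>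
    u (polar p) ^+ 2 * p.1^-1 ^+ (2 * j))).
  move=> [r t]; rewrite inE => -[/half_lineE /= r0 t1] /=.
  by rewrite (enorm_ray t1 (ltW r0)) exprVn.
apply: measurable_funM.
  by apply: measurable_funX; apply: measurable_funTS; exact: measurable_polar.
exact: (measurable_smooth_radius (smooth_posX (2 * j) smooth_pos_inv)).
Qed.

Lemma hardy_weight_ge0 k r : 0 <= hardy_weight n k r.
Proof.
by apply: sumr_ge0 => j _; rewrite mulr_ge0 ?hardy_coef_ge0// exprn_ge0// sqr_ge0.
Qed.

Lemma smooth_pos_hardy_weight k : smooth_pos (@hardy_weight R n k).
Proof.
rewrite /hardy_weight; elim: k.+1 => [|m IH].
  by apply: smooth_pos_eq (smooth_pos_cst 0) => r _; rewrite big_ord0.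
apply: smooth_pos_eq (smooth_posD IH (smooth_posZ (hardy_coef n k m)
  (smooth_posX m (smooth_posX 2 smooth_pos_inv)))) => r _.
by rewrite big_ord_recr.
Qed.

Lemma hyp_integral_hardy_weight k u : smooth u ->
  hyp_integral (fun x => hardy_weight n k (enorm x) * u x ^+ 2) =
  (\sum_(j < k.+1) (hardy_coef n k j)%:E *
     hyp_integral (fun x => u x ^+ 2 / enorm x ^+ (2 * j))%R)%E.
Proof.
move=> su; pose g j x : R := u x ^+ 2 / enorm x ^+ (2 * j).
have g0 j x : 0 <= g j x.
  by rewrite divr_ge0 ?sqr_ge0// exprn_ge0// sqrtr_ge0.
transitivity (\int[mu \x sg]_(p in D `*` S) \sum_(j < k.+1)
    ((hardy_coef n k j)%:E * (integrand (g j) p)%:E))%E.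
  apply: eq_integral => -[r t] _; rewrite /integrand /=.
  rewrite /hardy_weight -mulrA mulr_suml -sumEFin; apply: eq_bigr => j _.
  by rewrite -EFinM /g -exprM exprVn -!mulrA; congr (_%:E); ring.
rewrite ge0_integral_sum//; first last.
- move=> j p pD; apply: mule_ge0; first by rewrite lee_fin hardy_coef_ge0.
  exact: integrand_ge0.
- move=> j; apply: emeasurable_funM => //.
  by apply: measurable_integrand; exact: measurable_sqr_div.
- exact: measurable_polar_set.
apply: eq_bigr => j _; rewrite ge0_integralZl//.
- exact: measurable_polar_set.
- by apply: measurable_integrand; exact: measurable_sqr_div.
- exact: integrand_ge0.
- by rewrite lee_fin hardy_coef_ge0.
Qed.

(** The restrictions of u to all the rays are supported in one annulus away from
the pole, where the ray inequality applies. *)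
Lemma hardy_rellich_hyp k u : (2 * k <= n)%N -> test_function u ->
  (hyp_integral (fun x => hardy_weight n k (enorm x) * u x ^+ 2)%R <=
   hyp_integral (nabla_r_sq k u))%E.
Proof.
move=> kn tu; have [a [b [M [a0 b0 uab _]]]] := test_function_bounds tu.
have su : smooth u by have [] := tu.
have cu : continuous u by have [] := su 0%N.
apply: hyp_integral_le.
- by move=> x; rewrite mulr_ge0 ?hardy_weight_ge0// sqr_ge0.
- by move=> x; rewrite /nabla_r_sq; case: ifP => _; exact: sqr_ge0.
- apply: (eq_measurable_fun (fun p : mR * N.-tuple mR =>
      hardy_weight n k p.1 * u (polar p) ^+ 2)).
    move=> [r t]; rewrite inE => -[/half_lineE /= r0 t1] /=.
    by rewrite (enorm_ray t1 (ltW r0)).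
  apply: measurable_funM.
    exact: (measurable_smooth_radius (smooth_pos_hardy_weight k)).
  by apply: measurable_funX; apply: measurable_funTS; exact: measurable_polar.
- exact: measurable_nabla.
move=> x x1; pose f t := u (t *: x).
have tf : test_on a b f.
  by split; [exact: smooth_ray|move=> r r0; exact: uab].
have sn : smooth_pos (ray_nabla n k f).
  have [sg _] := test_on_iter n k./2 tf.
  rewrite /ray_nabla; case: (odd k) => //; exact: smooth_pos_derive.
have sw := smooth_posX n (@smooth_pos_sinh R).
have E1 : (\int[mu]_(r in D) (hardy_weight n k (enorm (r *: x))
                                * u (r *: x) ^+ 2 * sinh r ^+ n)%:E =
    \int[mu]_(r in D) (hardy_weight n k r * f r ^+ 2 * sinh r ^+ n)%:E)%E.
  apply: eq_integral => r; rewrite inE => /half_lineE r0.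
  by rewrite (enorm_ray x1 (ltW r0)).
have E2 : (\int[mu]_(r in D) (nabla_r_sq k u (r *: x) * sinh r ^+ n)%:E =
    \int[mu]_(r in D) (ray_nabla n k f r ^+ 2 * sinh r ^+ n)%:E)%E.
  by apply: eq_integral => r; rewrite inE => /half_lineE r0; rewrite nabla_ray.
rewrite /= E1 E2; apply: (le_exact_integral a0 (hardy_rellich_exact kn tf)).
- apply: measurable_smooth_pos; apply: smooth_posM => //; apply: smooth_posM.
    exact: smooth_pos_hardy_weight.
  by apply: smooth_posX; have [] := tf.
- by apply: measurable_smooth_pos; apply: smooth_posM => //; exact: smooth_posX.
- move=> r /sinh_gt0/ltW s0; apply: mulr_ge0; last exact: exprn_ge0.
  by apply: mulr_ge0; [exact: hardy_weight_ge0|exact: sqr_ge0].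
- by move=> r /sinh_gt0/ltW s0; apply: mulr_ge0; [exact: sqr_ge0|exact: exprn_ge0].
Qed.

End integration.

Theorem theorem4p1 (R : realType) (k N : nat) (k_gt0 : (0 < k)%N)
    (N_gt2k : (2 * k < N)%N) :
  exists C : nat -> R,
    [/\ forall i : nat, (1 <= i <= k)%N -> 0 < C i,
        C k = leading_const N k,
        C 1%N = first_const N k &
        forall u : 'rV[R]_N -> R, test_function u ->
          (\sum_(1 <= i < k.+1)
              (C i)%:E * hyp_integral (fun x => u x ^+ 2 / enorm x ^+ (2 * i))%R
           <= hyp_integral (nabla_r_sq k u)
              - (((N%:R - 1) / 2) ^+ (2 * k))%:E
                * hyp_integral (fun x => u x ^+ 2)%R)%E].
Proof.
case: N N_gt2k => [//|n]; rewrite ltnS => kn.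
exists (hardy_coef n k); split.
- by move=> i; exact: hardy_coef_gt0.
- exact: hardy_coef_leading.
- exact: hardy_coef_first.
move=> u tu; have su : smooth u by have [] := tu.
have I0 : (0 <= hyp_integral (fun x => u x ^+ 2)%R)%E.
  by apply: integral_ge0 => -[r t] [/half_lineE /= r0 _];
    rewrite lee_fin mulr_ge0 ?sqr_ge0// exprn_ge0// ltW// sinh_gt0.
have fin : hyp_integral (fun x => u x ^+ 2)%R \is a fin_num.
  by rewrite ge0_fin_numE// hyp_integral_sqr_fin.
rewrite leeBrDr ?fin_numM//; apply: le_trans (hardy_rellich_hyp kn tu).
rewrite hyp_integral_hardy_weight// big_ord_recl /= hardy_coef0 -(natr1 n) addrK.
rewrite addeC big_add1 /= big_mkord; apply: leeD => //.
rewrite [leRHS](_ : _ = ((n%:R / 2) ^+ (2 * k))%:E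
  * hyp_integral (fun x => u x ^+ 2)%R)%E//.
by congr (_ * hyp_integral _)%E; apply/funext => x; rewrite muln0 expr0 divr1.
Qed.
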